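(* Let $n\ge 1$. Let $e\in B(\tilde A_n)$ be the element $$e=a_{n+1}^{-1}\,\sigma_n^{-1}\sigma_{n-1}^{-1}\cdots\sigma_2^{-1}\,\sigma_1\,\sigma_2\cdots\sigma_{n-1}\sigma_n,$$ and let $N_e$ be the normal subgroup of $B(\tilde A_n)$ generated by $e$ (the normal closure of $e$). Then $N_e$, which is the kernel of the surjective homomorphism $\beta_n: B(\tilde A_n)\to B(A_n)$, is an infinitely generated free group (that is, a free group of infinite rank).
   Context: $B(A_n)$ is the group with generators $\sigma_1,\dots,\sigma_n$ and relations $\sigma_i\sigma_j=\sigma_j\sigma_i$ for $|i-j|\ge 2$ and $\sigma_i\sigma_{i+1}\sigma_i=\sigma_{i+1}\sigma_i\sigma_{i+1}$ for $1\le i\le n-1$ (the braid group on $n+1$ strands). For $n\ge 2$, $B(\tilde A_n)$ is the group with generators $\sigma_1,\dots,\sigma_n,a_{n+1}$ and relations: $\sigma_i\sigma_j=\sigma_j\sigma_i$ for $1\le i,j\le n$, $|i-j|\ge2$; $\sigma_i\sigma_{i+1}\sigma_i=\sigma_{i+1}\sigma_i\sigma_{i+1}$ for $1\le i\le n-1$; $\sigma_i a_{n+1}=a_{n+1}\sigma_i$ for $2\le i\le n-1$; $\sigma_1a_{n+1}\sigma_1=a_{n+1}\sigma_1a_{n+1}$; $\sigma_na_{n+1}\sigma_n=a_{n+1}\sigma_na_{n+1}$. For $n=1$, $B(\tilde A_1)$ is the free group on $\sigma_1,a_2$. The homomorphism $\beta_n: B(\tilde A_n)\to B(A_n)$ is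 given by $\sigma_i\mapsto\sigma_i$ for $1\le i\le n$ and $a_{n+1}\mapsto\sigma_n^{-1}\cdots\sigma_2^{-1}\sigma_1\sigma_2\cdots\sigma_n$. *)

(* Defs.v *)
From HB Require Import structures.
From mathcomp Require Import all_boot.
From mathcomp Require Import boolp classical_sets functions cardinality.
Set Implicit Arguments.
Unset Strict Implicit.
Unset Printing Implicit Defensive.

Local Open Scope group_scope.
Local Open Scope classical_set_scope.
Local Open Scope quotient_scope.

(* A word in the letters x, x^-1 (x : X); the letter (x, b) stands for x if
   b = true and for x^-1 if b = false. *)
Definition word (X : Type) : Type := seq (X * bool).

Definition gen_letter (X : Type) (x : X) : X * bool := (x, true).

Definition word_inv (X : Type) (w : word X) : word X :=
  rev [seq (l.1, ~~ l.2) | l <- w].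

(* R u v is read as the defining relation u = v. *)
Inductive word_cong (X : Type) (R : word X -> word X -> Prop) :
    word X -> word X -> Prop :=
| cong_rel u v : R u v -> word_cong R u v
| cong_cancel x b : word_cong R [:: (x, b); (x, ~~ b)] [::]
| cong_refl u : word_cong R u u
| cong_sym u v : word_cong R u v -> word_cong R v u
| cong_trans u v w : word_cong R u v -> word_cong R v w -> word_cong R u w
| cong_cat u u' v v' :
    word_cong R u u' -> word_cong R v v' -> word_cong R (u ++ v) (u' ++ v').

Definition word_eqv (X : choiceType) (R : word X -> word X -> Prop) :
  rel (seq (X * bool)) := fun u v => `[< word_cong R u v >].

Section PresentedGroup.
Context (X : choiceType) (R : word X -> word X -> Prop).

Lemma word_eqv_refl : reflexive (word_eqv R).
Proof. by move=> u; apply/asboolP/cong_refl. Qed.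

Lemma word_eqv_sym : symmetric (word_eqv R).
Proof.
by move=> u v; apply/asboolP/asboolP => /cong_sym.
Qed.

Lemma word_eqv_trans : transitive (word_eqv R).
Proof.
by move=> v u w /asboolP uv /asboolP vw; apply/asboolP/(cong_trans uv vw).
Qed.

Canonical word_eqv_equiv :=
  EquivRel (word_eqv R) word_eqv_refl word_eqv_sym word_eqv_trans.

Definition presented : Type := {eq_quot word_eqv_equiv}.

HB.instance Definition _ := Choice.on presented.

Definition pres_class (w : word X) : presented :=
  \pi_({eq_quot word_eqv_equiv}) w.
Definition pres_repr (g : presented) : word X :=
  repr (g : {eq_quot word_eqv_equiv}).

Lemma pres_reprK (g : presented) : pres_class (pres_repr g) = g.
Proof. exact: reprK. Qed.

Lemma pres_classP (u v : word X) :
  pres_class u = pres_class v <-> word_cong R u v.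
Proof.
split=> [/eqquotP /asboolP //|uv].
by apply/eqquotP/asboolP.
Qed.

Lemma pres_repr_class (w : word X) : word_cong R (pres_repr (pres_class w)) w.
Proof. by apply/pres_classP; rewrite pres_reprK. Qed.

Definition pres_mul (g h : presented) : presented :=
  pres_class (pres_repr g ++ pres_repr h).
Definition pres_one : presented := pres_class [::].
Definition pres_inv (g : presented) : presented :=
  pres_class (word_inv (pres_repr g)).

Lemma pres_mulE u v :
  pres_mul (pres_class u) (pres_class v) = pres_class (u ++ v).
Proof. by apply/pres_classP/cong_cat; apply: pres_repr_class. Qed.

Lemma word_inv_cons l (w : word X) :
  word_inv (l :: w) = word_inv w ++ [:: (l.1, ~~ l.2)].
Proof. by rewrite /word_inv /= rev_cons cats1. Qed.

Lemma word_invK : involutive (@word_inv X).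
Proof.
move=> w; rewrite /word_inv map_rev revK -map_comp -[RHS]map_id.
by apply: eq_map => -[x b] /=; rewrite negbK.
Qed.

Lemma word_cong_invl (w : word X) : word_cong R (word_inv w ++ w) [::].
Proof.
elim: w => [|[x b] w IHw]; first exact: cong_refl.
rewrite word_inv_cons -catA /=.
apply: cong_trans IHw; apply: cong_cat; first exact: cong_refl.
apply: (@cong_cat X R [:: (x, ~~ b); (x, b)] [::]); last exact: cong_refl.
by have := cong_cancel R x (~~ b); rewrite negbK.
Qed.

Lemma word_cong_invr (w : word X) : word_cong R (w ++ word_inv w) [::].
Proof. by rewrite -{1}[w]word_invK; apply: word_cong_invl. Qed.

Lemma pres_mulA : associative pres_mul.
Proof.
move=> g h k; rewrite -[g]pres_reprK -[h]pres_reprK -[k]pres_reprK.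
by rewrite !pres_mulE catA.
Qed.

Lemma pres_mul1g : left_id pres_one pres_mul.
Proof. by move=> g; rewrite -[g]pres_reprK pres_mulE. Qed.

Lemma pres_mulg1 : right_id pres_one pres_mul.
Proof. by move=> g; rewrite -[g]pres_reprK pres_mulE cats0. Qed.

Lemma pres_mulVg : left_inverse pres_one pres_inv pres_mul.
Proof.
move=> g; rewrite -[X in pres_mul _ X]pres_reprK pres_mulE.
exact/pres_classP/word_cong_invl.
Qed.

Lemma pres_mulgV : right_inverse pres_one pres_inv pres_mul.
Proof.
move=> g; rewrite -[X in pres_mul X _]pres_reprK pres_mulE.
exact/pres_classP/word_cong_invr.
Qed.

HB.instance Definition _ := isGroup.Build presented
  pres_mulA pres_mul1g pres_mulg1 pres_mulVg pres_mulgV.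

Definition pres_gen (x : X) : presented := pres_class [:: gen_letter x].

Lemma pres_class_cat u v : pres_class (u ++ v) = pres_class u * pres_class v.
Proof. by rewrite -pres_mulE. Qed.

Lemma pres_class_gens (xs : seq X) :
  pres_class [seq gen_letter x | x <- xs] = \prod_(x <- xs) pres_gen x.
Proof.
elim: xs => [|x xs IHxs]; first by rewrite big_nil.
by rewrite big_cons -IHxs -pres_class_cat.
Qed.

Section Lift.
Context (G : groupType) (f : X -> G).

Definition word_eval (w : word X) : G :=
  \prod_(l <- w) (if l.2 then f l.1 else (f l.1)^-1).

Lemma word_eval_cong :
    (forall u v, R u v -> word_eval u = word_eval v) ->
  forall u v, word_cong R u v -> word_eval u = word_eval v.
Proof.
move=> fR u v; elim=> {u v} //.
- by move=> x [] /=; rewrite /word_eval !big_cons !big_nil /= mulg1 ?mulgV ?mulVg.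
- by move=> u v w _ -> _ ->.
- by move=> u u' v v' _ + _; rewrite /word_eval !big_cat /= => -> ->.
Qed.

Context (fR : forall u v, R u v -> word_eval u = word_eval v).

(* The homomorphism sending each generator x to f x; it exists because f
   respects the defining relations (fR). *)
Definition pres_lift of (forall u v, R u v -> word_eval u = word_eval v) :
  presented -> G := fun g => word_eval (pres_repr g).

Lemma pres_lift_class w : pres_lift fR (pres_class w) = word_eval w.
Proof. exact: (word_eval_cong fR (pres_repr_class w)). Qed.

Lemma pres_lift_gen x : pres_lift fR (pres_gen x) = f x.
Proof. by rewrite pres_lift_class /word_eval big_seq1. Qed.

Lemma pres_liftM : {morph pres_lift fR : g h / g * h}.
Proof.
move=> g h; rewrite -[g]pres_reprK -[h]pres_reprK -pres_class_cat.
by rewrite !pres_lift_class /word_eval big_cat.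
Qed.

Lemma pres_lift1 : pres_lift fR 1 = 1.
Proof. by rewrite pres_lift_class /word_eval big_nil. Qed.

HB.instance Definition _ :=
  isMultiplicative.Build presented G (pres_lift fR) pres_liftM.
HB.instance Definition _ :=
  Multiplicative_isUMagmaMorphism.Build presented G (pres_lift fR) pres_lift1.

End Lift.
End PresentedGroup.

Definition no_relation (X : Type) (u v : word X) : Prop := False.

Definition free_group (X : choiceType) : groupType :=
  presented (@no_relation X).

Section Subgroups.
Context (G : groupType).

Definition normal_subgroup (H : set G) : Prop :=
  [/\ H 1, (forall x y, H x -> H y -> H (x * y)),
      (forall x, H x -> H x^-1) & (forall x g, H x -> H (x ^ g))].

Definition normal_closure (S : set G) : set G :=
  \bigcap_(H in [set H | normal_subgroup H /\ S `<=` H]) H.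

(* N is isomorphic to the free group on some infinite set X: the isomorphism
   is f, seen as an injective homomorphism with image N. *)
Definition free_of_infinite_rank (N : set G) : Prop :=
  exists (X : choiceType) (f : {multiplicative free_group X -> G}),
    [/\ infinite_set [set: X], injective f & range f = N].

End Subgroups.

Definition morph_ker (G H : groupType) (f : G -> H) : set G := [set g | f g = 1].

(* Generators are numbered from 0: the ordinal i : 'I_n stands for
   sigma_(i+1). *)
Inductive braid_rel (n : nat) : word 'I_n -> word 'I_n -> Prop :=
| braid_comm (i j : 'I_n) : (i.+2 <= j \/ j.+2 <= i)%N ->
    braid_rel [seq gen_letter k | k <- [:: i; j]]
              [seq gen_letter k | k <- [:: j; i]]
| braid_braid (i j : 'I_n) : (i.+1 = j)%N ->
    braid_rel [seq gen_letter k | k <- [:: i; j; i]]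
              [seq gen_letter k | k <- [:: j; i; j]].

Definition braid_A (n : nat) : groupType := presented (@braid_rel n).

Definition sigma (n : nat) (i : 'I_n) : braid_A n := pres_gen (@braid_rel n) i.

(* Some i stands for sigma_(i+1) and None for a_(n+1). No relation applies
   when n = 1, so that the group is then free on sigma_1, a_2. *)
Inductive affine_rel (n : nat) :
    word (option 'I_n) -> word (option 'I_n) -> Prop :=
| affine_comm (i j : 'I_n) : (i.+2 <= j \/ j.+2 <= i)%N ->
    affine_rel [seq gen_letter k | k <- [:: Some i; Some j]]
               [seq gen_letter k | k <- [:: Some j; Some i]]
| affine_braid (i j : 'I_n) : (i.+1 = j)%N ->
    affine_rel [seq gen_letter k | k <- [:: Some i; Some j; Some i]]
               [seq gen_letter k | k <- [:: Some j; Some i; Some j]]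
| affine_comm_a (i : 'I_n) : (0 < i)%N -> (i.+1 < n)%N ->
    affine_rel [seq gen_letter k | k <- [:: Some i; None]]
               [seq gen_letter k | k <- [:: None; Some i]]
| affine_braid_first (i : 'I_n) : (2 <= n)%N -> (i = 0 :> nat)%N ->
    affine_rel [seq gen_letter k | k <- [:: Some i; None; Some i]]
               [seq gen_letter k | k <- [:: None; Some i; None]]
| affine_braid_last (i : 'I_n) : (2 <= n)%N -> (i.+1 = n)%N ->
    affine_rel [seq gen_letter k | k <- [:: Some i; None; Some i]]
               [seq gen_letter k | k <- [:: None; Some i; None]].

Definition braid_affA (n : nat) : groupType := presented (@affine_rel n).

Definition aff_sigma (n : nat) (i : 'I_n) : braid_affA n :=
  pres_gen (@affine_rel n) (Some i).

Definition aff_a (n : nat) : braid_affA n := pres_gen (@affine_rel n) None.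

(* For a family s_1, ..., s_n (numbered from 0 here), the element
   s_n^-1 ... s_2^-1 s_1 s_2 ... s_n. *)
Definition tail_conj (G : groupType) (n : nat) (n_gt0 : (0 < n)%N)
    (s : 'I_n -> G) : G :=
  (\prod_(i <- rev (enum 'I_n) | (0 < i)%N) (s i)^-1)
    * s (Ordinal n_gt0) * \prod_(i < n | (0 < i)%N) s i.

Definition aff_e (n : nat) (n_gt0 : (0 < n)%N) : braid_affA n :=
  (aff_a n)^-1 * tail_conj n_gt0 (@aff_sigma n).

Section BraidRelation.
Context (G : groupType).
Implicit Types x y z g : G.

Let brd x y := x * y * x = y * x * y.

Lemma brd_sym x y : brd x y -> brd y x.
Proof. by []. Qed.

Lemma brd_conj x y g : brd x y -> brd (x ^ g) (y ^ g).
Proof. by rewrite /brd -!conjMg => ->. Qed.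

Lemma commute_conj x y g : commute x y -> commute (x ^ g) (y ^ g).
Proof. by rewrite /commute -!conjMg => ->. Qed.

Lemma conj_commute x g : commute x g -> x ^ g = x.
Proof. by rewrite /conjg => ->; rewrite mulKg. Qed.

Lemma brd_conjE x y : brd x y -> x ^ y = y ^ x^-1.
Proof.
move=> xy; rewrite /conjg invgK; apply: (@mulgI _ y); rewrite mulVKg !mulgA.
by apply: (@mulIg _ x); rewrite mulgVK.
Qed.

Lemma brd_conj_commute x y z : brd x y -> commute x z -> brd y z ->
  brd (x ^ y) z.
Proof.
move=> xy xz yz; rewrite (brd_conjE xy).
rewrite -(@conj_commute z x^-1); last exact/commuteV/commute_sym.
exact: brd_conj.
Qed.

Context (s : nat -> G) (n : nat).
Context (s_comm : forall i j, (i.+1 < j)%N -> (j < n)%N -> commute (s i) (s j)).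
Context (s_braid : forall i, (i.+1 < n)%N -> brd (s i) (s i.+1)).

Fixpoint tail_iter k : G := if k is k'.+1 then tail_iter k' ^ s k else s 0%N.

Lemma tail_iter_comm_far k j : (k.+1 < j)%N -> (j < n)%N ->
  commute (tail_iter k) (s j).
Proof.
elim: k => [|k IHk] kj jn /=; first exact: s_comm.
rewrite -(@conj_commute (s j) (s k.+1)); last exact/commute_sym/s_comm.
by apply/commute_conj/IHk => //; apply: ltnW.
Qed.

Lemma tail_iter_braid_next k : (k.+1 < n)%N -> brd (tail_iter k) (s k.+1).
Proof.
elim: k => [|k IHk] kn /=; first exact: s_braid.
apply: brd_conj_commute; [exact/IHk/ltnW | | exact: s_braid].
exact: tail_iter_comm_far.
Qed.

Lemma tail_iter_braid_last k : (k.+1 < n)%N -> brd (tail_iter k.+1) (s k.+1).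
Proof.
move=> kn /=; rewrite -[s k.+1 in X in brd _ X](@conj_commute _ (s k.+1)) //.
exact/brd_conj/tail_iter_braid_next.
Qed.

Lemma tail_iter_braid_first k : (k.+1 < n)%N -> brd (tail_iter k.+1) (s 0%N).
Proof.
elim: k => [|k IHk] kn.
  rewrite /= (brd_conjE (s_braid kn)) -[X in brd _ X](@conj_commute _ (s 0%N)^-1).
    exact/brd_conj/brd_sym/s_braid.
  exact/commuteV.
rewrite -(@conj_commute (s 0%N) (s k.+2)); last exact: s_comm.
exact/brd_conj/IHk/ltnW.
Qed.

Lemma tail_iter_comm k i : (0 < i)%N -> (i < k)%N -> (k < n)%N ->
  commute (tail_iter k) (s i).
Proof.
move=> i0; elim: k => // k IHk; rewrite ltnS leq_eqVlt => /predU1P[<-|ik] kn.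
  case: i i0 kn {IHk} => // i _ kn; rewrite /= -conjgM.
  have e : s i.+1 = s i.+2 ^ (s i.+1 * s i.+2).
    by rewrite conjgE [X in _ * X]mulgA -s_braid // mulKg.
  by rewrite [X in commute _ X]e; apply/commute_conj/tail_iter_comm_far.
rewrite -(@conj_commute (s i) (s k.+1)); last exact: s_comm.
by apply/commute_conj/IHk => //; apply: ltnW.
Qed.

End BraidRelation.

Definition nat_family (G : groupType) (n : nat) (s : 'I_n -> G) (i : nat) : G :=
  oapp s 1 (insub i).

Lemma nat_familyE (G : groupType) (n : nat) (s : 'I_n -> G) (i : 'I_n) :
  nat_family s i = s i.
Proof. by rewrite /nat_family valK. Qed.

Lemma tail_conjE (G : groupType) (n : nat) (n_gt0 : (0 < n)%N) (s : 'I_n -> G) :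
  tail_conj n_gt0 s = tail_iter (nat_family s) n.-1.
Proof.
have -> : tail_conj n_gt0 s = s (Ordinal n_gt0) ^ (\prod_(i < n | (0 < i)%N) s i).
  by rewrite /tail_conj prodgV revK [index_enum _]unlock -enumT conjgE mulgA.
rewrite -nat_familyE /=.
under eq_bigr => i _ do rewrite -nat_familyE.
rewrite -(big_mkord (fun i => 0 < i)%N (nat_family s)).
move: (nat_family s) => {}s; case: n n_gt0 s => // {}n _ s.
elim: n s => [|n IHn] s /=.
  by rewrite big_mkcond big_nat1 /= conjg1.
by rewrite big_mkcond big_nat_recr //= conjgM -big_mkcond IHn.
Qed.

Section Beta.
Context (n : nat) (n_gt0 : (0 < n)%N).

Lemma sigma_comm (i j : 'I_n) : (i.+2 <= j \/ j.+2 <= i)%N ->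
  commute (sigma i) (sigma j).
Proof.
move=> /braid_comm/cong_rel/pres_classP.
by rewrite !pres_class_gens !big_cons !big_nil !mulg1.
Qed.

Lemma sigma_braid (i j : 'I_n) : (i.+1 = j)%N ->
  sigma i * sigma j * sigma i = sigma j * sigma i * sigma j.
Proof.
move=> /braid_braid/cong_rel/pres_classP.
by rewrite !pres_class_gens !big_cons !big_nil !mulg1 !mulgA.
Qed.

Definition beta_gen (x : option 'I_n) : braid_A n :=
  if x is Some i then sigma i else tail_conj n_gt0 (@sigma n).

Lemma beta_gen_rel (u v : word (option 'I_n)) :
  affine_rel u v -> word_eval beta_gen u = word_eval beta_gen v.
Proof.
have nf i (lin : (i < n)%N) : nat_family (@sigma n) i = sigma (Ordinal lin).
  exact: (nat_familyE _ (Ordinal lin)).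
have ncomm i j : (i.+1 < j)%N -> (j < n)%N ->
    commute (nat_family (@sigma n) i) (nat_family (@sigma n) j).
  move=> ij jn; have lin : (i < n)%N by apply: ltn_trans jn; apply: ltnW.
  by rewrite !nf; apply: sigma_comm; left.
have nbraid i : (i.+1 < n)%N -> nat_family (@sigma n) i *
    nat_family (@sigma n) i.+1 * nat_family (@sigma n) i =
    nat_family (@sigma n) i.+1 * nat_family (@sigma n) i *
    nat_family (@sigma n) i.+1.
  by move=> iSn; have lin := ltnW iSn; rewrite !nf; apply: sigma_braid.
have n2 : (2 <= n)%N -> n.-1 = n.-2.+1 /\ (n.-2.+1 < n)%N.
  by case: n => [|[|m]].
case=> {u v}; rewrite /word_eval.
- by move=> i j ij; rewrite !big_cons big_nil /= !mulg1; apply: sigma_comm.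
- move=> i j ij; rewrite !big_cons big_nil /= !mulg1 !mulgA.
  exact: sigma_braid.
- move=> i i0 iSn; rewrite !big_cons big_nil /= !mulg1 tail_conjE -nat_familyE.
  apply/commute_sym/(tail_iter_comm ncomm nbraid) => //.
    by rewrite -ltnS prednK.
  by rewrite prednK.
- move=> i /n2[e lt] i0; rewrite !big_cons big_nil /= tail_conjE !mulg1 !mulgA.
  rewrite -nat_familyE i0 e.
  by apply: esym; apply: (tail_iter_braid_first ncomm nbraid).
- move=> i /n2[e lt] im; rewrite !big_cons big_nil /= tail_conjE !mulg1 !mulgA.
  rewrite -nat_familyE (_ : nat_of_ord i = n.-2.+1); last first.
    by apply: succn_inj; rewrite -e prednK.
  rewrite e.
  by apply: esym; apply: (tail_iter_braid_last ncomm nbraid).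
Qed.

Definition beta : {multiplicative braid_affA n -> braid_A n} :=
  pres_lift beta_gen_rel.

Lemma beta_sigma (i : 'I_n) : beta (aff_sigma i) = sigma i.
Proof. exact: pres_lift_gen. Qed.

Lemma beta_a : beta (aff_a n) = tail_conj n_gt0 (@sigma n).
Proof. exact: pres_lift_gen. Qed.

End Beta.

(* Main.v *)
Require Import Defs.
From HB Require Import structures.
From mathcomp Require Import all_boot.
From mathcomp Require Import ssralg ssrint zify.
From mathcomp Require Import boolp classical_sets functions cardinality.
Set Implicit Arguments.
Unset Strict Implicit.
Unset Printing Implicit Defensive.
Local Open Scope group_scope.
Local Open Scope classical_set_scope.

(** Write [n = m + 1]. The proof takes place in the annular braid group, the
    Artin group of type B on [s 0, ..., s m] and [t], where [t] commutes with
    every [s i] except [s 0] and [s_0 t s_0 t = t s_0 t s_0]. It is a semidirect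
    product of the free group F on the [n + 1] loops [loop 0 = t, ..., loop n]
    by the braid group, which acts on F by Artin's formulas.

    Conjugation by [rotation = t s_0 ... s_m] permutes cyclically the [s i] and
    one further element, which satisfy the relations of the affine braid group
    ([rotated_cyclic]); this defines a homomorphism [aff_emb] from the affine
    to the annular braid group. It is injective ([aff_emb_inj]): conversely,
    the affine braid group has an automorphism that permutes its generators
    cyclically, and together with left translations it makes the annular braid
    group act on the set of elements of the affine one, in such a way that the
    affine group acts by left multiplication.

    The map that forgets [t] extends [beta] ([ann_proj_emb]), and [aff_emb]
    sends [e] to [t (loop n)^-1] ([aff_emb_e]). So the kernel of [beta] should
    be the kernel of the total exponent F -> Z, which is freely generated by
    the shifted loops [t^k (loop i) t^-1 t^-k] for [1 <= i <= n] and k in Z.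
    Three facts establish this. The subgroup of the shifted loops is normal
    ([shifted_loops_normal]), so that it contains the image of the normal
    closure of [e]. It is free on the shifted loops ([loop_eval_inj]), by the
    Artin representation, which turns the loops into translations by the
    generators of a free group. The kernel of [beta] is the normal closure of
    [e], as [beta] has a section ([normal_closure_beta]). *)

(** * Homomorphisms and presented groups *)

Section Hom.
Context (G H : groupType) (f : {multiplicative G -> H}).

Lemma hom1 : f 1 = 1.
Proof. by apply: (@mulgI _ (f 1)); rewrite -gmulfM !mulg1. Qed.

Lemma homV : {morph f : x / x^-1}.
Proof. by move=> x; apply/esym/mulg1_eq; rewrite -gmulfM mulgV hom1. Qed.

Lemma homJ : {morph f : x y / x ^ y}.
Proof. by move=> x y; rewrite !gmulfM homV. Qed.

Lemma homX n : {morph f : x / x ^+ n}.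
Proof. by elim: n => [|n IH] x; rewrite ?hom1 // !expgS gmulfM IH. Qed.

End Hom.

Section Presented.
Context (X : choiceType) (R : word X -> word X -> Prop).

Lemma pres_class_neg (x : X) :
  pres_class R [:: (x, false)] = (pres_gen R x)^-1.
Proof.
apply: esym; apply: mulg1_eq; rewrite -pres_class_cat.
exact/pres_classP/(cong_cancel R x true).
Qed.

Lemma presented_ind (Q : presented R -> Prop) : Q 1 ->
    (forall x g, Q g -> Q (pres_gen R x * g)) ->
    (forall x g, Q g -> Q ((pres_gen R x)^-1 * g)) ->
  forall g, Q g.
Proof.
move=> Q1 Qgen QgenV g; rewrite -[g]pres_reprK.
elim: (pres_repr g) => // -[x [|]] w IHw.
  by rewrite -cat1s pres_class_cat; apply: Qgen.
by rewrite -cat1s pres_class_cat pres_class_neg; apply: QgenV.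
Qed.

Lemma presented_hom_ext (G : groupType)
    (f g : {multiplicative presented R -> G}) :
  (forall x, f (pres_gen R x) = g (pres_gen R x)) -> f =1 g.
Proof.
move=> fg; elim/presented_ind => [|x h IH|x h IH].
- by rewrite !hom1.
- by rewrite !gmulfM fg IH.
- by rewrite !gmulfM !homV fg IH.
Qed.

End Presented.

Section FreeGroup.
Context (X : choiceType).

Definition free_gen (x : X) : free_group X := pres_gen (@no_relation X) x.

Lemma no_relation_eval (G : groupType) (f : X -> G) u v :
  no_relation u v -> word_eval f u = word_eval f v.
Proof. by []. Qed.

Definition free_lift (G : groupType) (f : X -> G) :
  {multiplicative free_group X -> G} := pres_lift (no_relation_eval f).

Lemma free_lift_gen (G : groupType) (f : X -> G) x :
  free_lift f (free_gen x) = f x.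
Proof. exact: (pres_lift_gen (no_relation_eval f)). Qed.

Lemma free_hom_ext (G : groupType) (f g : {multiplicative free_group X -> G}) :
  (forall x, f (free_gen x) = g (free_gen x)) -> f =1 g.
Proof. exact: presented_hom_ext. Qed.

End FreeGroup.

(** * Groups of bijections *)

(** Left actions: a homomorphism to [sym T] is an action on [T], and a relation
    in the group is checked by evaluating both sides at a point. *)
Record sym (T : Type) := Sym {
  sym_fun :> T -> T;
  sym_inv : T -> T;
  sym_funK : cancel sym_fun sym_inv;
  sym_invK : cancel sym_inv sym_fun }.

HB.instance Definition _ T := gen_eqMixin (sym T).
HB.instance Definition _ T := gen_choiceMixin (sym T).

Section SymGroup.
Context (T : Type).
Implicit Types f g h : sym T.

Lemma sym_ext f g : f =1 g -> f = g.
Proof.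
case: f g => [f f' fK f'K] [g g' gK g'K] /= /funext fg; subst g.
have e : f' = g' by apply: funext => x; rewrite -[x in LHS]g'K fK.
by subst g'; congr Sym; apply: Prop_irrelevance.
Qed.

Definition sym_one := @Sym T id id (fun=> erefl) (fun=> erefl).
Definition sym_mul f g :=
  Sym (can_comp (sym_funK f) (sym_funK g)) (can_comp (sym_invK g) (sym_invK f)).
Definition sym_opp f := Sym (sym_invK f) (sym_funK f).

Lemma sym_mulA : associative sym_mul.
Proof. by move=> f g h; apply: sym_ext. Qed.
Lemma sym_mul1g : left_id sym_one sym_mul.
Proof. by move=> f; apply: sym_ext. Qed.
Lemma sym_mulg1 : right_id sym_one sym_mul.
Proof. by move=> f; apply: sym_ext. Qed.
Lemma sym_mulVg : left_inverse sym_one sym_opp sym_mul.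
Proof. by move=> f; apply: sym_ext => x; apply: sym_funK. Qed.
Lemma sym_mulgV : right_inverse sym_one sym_opp sym_mul.
Proof. by move=> f; apply: sym_ext => x; apply: sym_invK. Qed.

HB.instance Definition _ := isGroup.Build (sym T)
  sym_mulA sym_mul1g sym_mulg1 sym_mulVg sym_mulgV.

Lemma sym_mulE f g x : (f * g) x = f (g x). Proof. by []. Qed.

End SymGroup.

Section Translation.
Context (G : groupType).
Definition translation (g : G) : sym G := Sym (mulKg g) (mulVKg g).

Lemma translationM : {morph translation : g h / g * h}.
Proof. by move=> g h; apply: sym_ext => x; rewrite sym_mulE /= mulgA. Qed.
HB.instance Definition _ :=
  isMultiplicative.Build G (sym G) translation translationM.
End Translation.

(** The commutation rule of the holomorph of [G]. *)
Lemma translation_conj (G : groupType) (f : sym G) (g : G) :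
  {morph f : x y / x * y} -> f * translation g = translation (f g) * f.
Proof. by move=> fM; apply: sym_ext => x; rewrite !sym_mulE /= fM. Qed.

(** * Annular and cyclic families of braid generators *)

Definition brd (G : groupType) (x y : G) := x * y * x = y * x * y.

(** The relations of the Artin group of type B with [m + 2] generators
    [s 0, ..., s m] and [t]: geometrically, [t] carries the first of [m + 2]
    strands once around the core of an annulus. *)
Record annular (m : nat) (G : groupType) (s : nat -> G) (t : G) : Prop :=
  Annular {
    ann_comm : forall i j, i.+1 < j -> j <= m -> commute (s i) (s j);
    ann_brd : forall i, i < m -> brd (s i) (s i.+1);
    ann_comm_t : forall i, 0 < i -> i <= m -> commute t (s i);
    ann_quad : commute (s 0) (t * s 0 * t) }.

(** The relations of the affine braid group on [c 0, ..., c m.+1], written for a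
    periodic family indexed by all natural numbers, so that they are visibly
    invariant under the rotation of the indices. The bound [0 < m] discards
    the braid relation for two generators, which generate a free group. *)
Record cyclic_affine (m : nat) (G : groupType) (c : nat -> G) : Prop :=
  CyclicAffine {
    cyc_per : forall i, c (i + m.+2)%N = c i;
    cyc_brd : 0 < m -> forall i, brd (c i) (c i.+1);
    cyc_comm : forall i d, 1 < d -> d <= m -> commute (c i) (c (i + d)%N) }.

Fixpoint partial_prod (G : groupType) (s : nat -> G) (k : nat) : G :=
  if k is k'.+1 then partial_prod s k' * s k' else 1.

Lemma partial_prod_hom (G K : groupType) (f : {multiplicative G -> K}) s k :
  f (partial_prod s k) = partial_prod (f \o s) k.
Proof. by elim: k => [|k IH] /=; rewrite ?hom1 // gmulfM IH. Qed.

Lemma eq_partial_prod (G : groupType) (s s' : nat -> G) k :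
  (forall i, i < k -> s i = s' i) -> partial_prod s k = partial_prod s' k.
Proof.
elim: k => //= k IH ss'; rewrite IH ?ss' // => i ik; exact/ss'/ltnW.
Qed.

Section Coxeter.
Context (m : nat) (G : groupType) (s : nat -> G).
Context (s_comm : forall i j, i.+1 < j -> j <= m -> commute (s i) (s j)).
Context (s_brd : forall i, i < m -> brd (s i) (s i.+1)).
Let delta := partial_prod s m.+1.

Lemma partial_prod_comm k j : k < j -> j <= m -> commute (s j) (partial_prod s k).
Proof.
elim: k => [|k IH] kj jm /=; first exact: commute1.
by apply: commuteM; [apply: IH => //; apply: ltnW | apply/commute_sym/s_comm].
Qed.

(** The Coxeter element of the first [k] braid generators conjugates each of
    them but the last to the next one. *)
Lemma partial_prod_shift k i : i.+1 < k -> k <= m.+1 ->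
  partial_prod s k * s i = s i.+1 * partial_prod s k.
Proof.
elim: k => // k IH; rewrite ltnS leq_eqVlt => /predU1P[<- km|ik km] /=.
  rewrite -2!mulgA (mulgA (s i)) s_brd // !mulgA; congr (_ * _ * _).
  exact/esym/partial_prod_comm.
by rewrite -mulgA -s_comm // mulgA IH ?mulgA // ltnW.
Qed.

Lemma delta_shift i : i < m -> delta * s i = s i.+1 * delta.
Proof. by move=> im; apply: partial_prod_shift. Qed.

Lemma delta_partial_prod k : k <= m ->
  delta * partial_prod s k = (s 0)^-1 * partial_prod s k.+1 * delta.
Proof.
elim: k => [|k IH] km; first by rewrite /= !gnorm.
rewrite [partial_prod s k.+1 in LHS]/= mulgA IH ?(ltnW km) // -mulgA.
by rewrite delta_shift //= !mulgA.
Qed.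

End Coxeter.

Section Rotation.
Context (m : nat) (G : groupType) (s : nat -> G) (t : G).
Hypothesis st : annular m s t.
Definition rotation := t * partial_prod s m.+1.
Definition rotated i := s 0 ^ (rotation ^+ i)^-1.

(** [rotation] turns the annulus by one strand: it conjugates [s i] to
    [s i.+1], and two turns bring the last generator [s m] to [s 0] because
    the missing generator lies between them. Hence conjugation by [rotation]
    permutes [m + 2] elements cyclically, of which [s 0, ..., s m] are the
    first ones. *)
Lemma rotation_shift i : i < m -> rotation * s i = s i.+1 * rotation.
Proof.
move=> im; rewrite /rotation -mulgA (delta_shift (ann_comm st) (ann_brd st)) //.
by rewrite !mulgA (ann_comm_t st).
Qed.

(** With [d] the product of all [s i] and [p] that of all but the last, the
    square of [rotation] is [(t s_0 t) (d p)]: here [s 0] commutes with the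
    first factor and [d p] conjugates [s m] to [s 0]. *)
Lemma rotation2_last : rotation ^+ 2 * s m = s 0 * rotation ^+ 2.
Proof.
rewrite expg2; set d := partial_prod s m.+1.
have e : rotation * rotation = t * s 0 * t * (d * partial_prod s m).
  rewrite (delta_partial_prod (ann_comm st) (ann_brd st) (leqnn m)) -/d.
  have cu k : k <= m -> commute t ((s 0)^-1 * partial_prod s k.+1).
    elim: k => [_|k IH km].
      by rewrite /= mul1g mulVg; apply: commute1.
    rewrite -[partial_prod s k.+2]/(partial_prod s k.+1 * s k.+1) mulgA.
    by apply: commuteM; [apply/IH/ltnW | apply: (ann_comm_t st)].
  have {}cu : t * ((s 0)^-1 * d) = (s 0)^-1 * d * t := cu m (leqnn m).
  have -> : t * s 0 * t * ((s 0)^-1 * d * d) =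
      t * s 0 * (t * ((s 0)^-1 * d)) * d.
    by rewrite !mulgA.
  by rewrite cu /rotation !mulgA mulgK.
have e' : d * partial_prod s m * s m = s 0 * (d * partial_prod s m).
  rewrite [in RHS](delta_partial_prod (ann_comm st) (ann_brd st) (leqnn m)) -/d.
  by rewrite -(mulgA _ d d) mulVKg -mulgA.
rewrite e -mulgA e' [LHS]mulgA [RHS]mulgA.
by congr (_ * _); apply/esym/(ann_quad st).
Qed.

Lemma rotatedD i j : rotated (i + j) = rotated j ^ (rotation ^+ i)^-1.
Proof. by rewrite /rotated -conjgM -invgM expgnDr. Qed.

Lemma rotatedS i : rotated i.+1 = rotated i ^ rotation^-1.
Proof. exact: (rotatedD 1). Qed.

Lemma rotated_s i : i <= m -> rotated i = s i.
Proof.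
elim: i => [_|i IH im]; first by rewrite /rotated expg0 invg1 conjg1.
rewrite -add1n rotatedD IH ?(ltnW im) // expg1 conjgE invgK mulgA.
by rewrite rotation_shift // mulgK.
Qed.

Lemma rotated_per i : rotated (i + m.+2) = rotated i.
Proof.
have e : rotated m.+2 = s 0.
  rewrite -add2n rotatedD rotated_s // conjgE invgK [LHS]mulgA.
  by rewrite rotation2_last mulgK.
by rewrite rotatedD e.
Qed.

(** Every relation is the conjugate by a power of [rotation] of a relation that
    involves [s 0]. *)
Lemma rotated_cyclic : cyclic_affine m rotated.
Proof.
split=> [|m0 i|i d d1 dm]; first exact: rotated_per.
  rewrite -[i]addn0 -addnS !rotatedD; apply: brd_conj.
  by rewrite !rotated_s //; apply: (ann_brd st).
rewrite -[i in rotated i]addn0 !rotatedD; apply: commute_conj.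
by rewrite !rotated_s //; apply: (ann_comm st).
Qed.

Lemma rotation_partial_prod k : k <= m ->
  rotation * partial_prod s k = (s 0)^-1 * partial_prod s k.+1 * rotation.
Proof.
elim: k => [|k IH] km; first by rewrite /= mulg1 mul1g mulVg mul1g.
rewrite [partial_prod s k.+1 in LHS]/= mulgA IH ?(ltnW km) // -mulgA.
by rewrite rotation_shift //= !mulgA.
Qed.

(** The left-hand side is the element [e] of the affine braid group once its
    last generator is identified with [rotated m.+1]. *)
Lemma rotated_last_conj :
  (rotated m.+1)^-1 * s 0 ^ partial_prod s m.+1 =
    (t ^ partial_prod s m.+1 * t^-1)^-1.
Proof.
have e := rotation_partial_prod (leqnn m).
rewrite rotatedS rotated_s // !conjgE.
have -> : s m = (partial_prod s m)^-1 * partial_prod s m.+1 by rewrite /= mulKg.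
rewrite /rotation in e *.
move: (partial_prod s m) (partial_prod s m.+1) e => p d e.
have ep : t * d * p^-1 = d^-1 * s 0 * (t * d).
  by apply: (@mulIg _ p); rewrite mulgVK -[RHS]mulgA e -!mulgA mulVKg mulKg.
have -> : (t * d)^-1^-1 * (p^-1 * d * (t * d)^-1) = d^-1 * s 0 * t * d * t^-1.
  by rewrite invgK !mulgA ep invgM !mulgA mulgK.
by rewrite !invgM !invgK !mulgA mulgK mulgVK.
Qed.

End Rotation.

(** The converse of [rotated_cyclic]: an element which rotates a cyclic family
    yields back the generator [t]. *)
Lemma annular_of_rotation (m : nat) (G : groupType) (c : nat -> G) (r : G) :
    cyclic_affine m c -> (forall i, r * c i = c i.+1 * r) ->
  annular m c (r * (partial_prod c m.+1)^-1).
Proof.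
move=> cc rc; set d := partial_prod c m.+1.
have comm i j : i.+1 < j -> j <= m -> commute (c i) (c j).
  move=> ij jm; have -> : j = (i + (j - i))%N by lia.
  by apply: (cyc_comm cc); lia.
have cbrd i : i < m -> brd (c i) (c i.+1).
  by move=> im; apply: (cyc_brd cc); lia.
split=> // [i i0 im|].
  case: i i0 im => // i _ im; rewrite /commute -mulgA.
  have -> : d^-1 * c i.+1 = c i * d^-1.
    by apply: (@mulgI _ d); rewrite mulVKg mulgA (delta_shift comm cbrd) // mulgK.
  by rewrite !mulgA rc.
have rp k : r * partial_prod c k = (c 0)^-1 * partial_prod c k.+1 * r.
  elim: k => [|k IH] /=; first by rewrite !gnorm.
  by rewrite mulgA IH /= -!mulgA rc.
have rdV : d^-1 * c 0 * r = r * (partial_prod c m)^-1.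
  have e : d^-1 * c 0 * r * partial_prod c m = r.
    by rewrite -mulgA rp -/d -(mulgA _ d) -mulgA mulVKg mulKg.
  by apply: (@mulIg _ (partial_prod c m)); rewrite mulgVK -[RHS]e.
have r2 : c 0 * (r * r) = r * r * c m.
  have e : c m.+2 = c 0 := cyc_per cc 0.
  by rewrite -e -(mulgA r r) rc (mulgA r) rc -!mulgA.
have dd := delta_partial_prod comm cbrd (leqnn m); rewrite -/d in dd.
have -> : r * d^-1 * c 0 * (r * d^-1) = r * r * (partial_prod c m)^-1 * d^-1.
  have -> : r * d^-1 * c 0 * (r * d^-1) = r * (d^-1 * c 0 * r) * d^-1.
    by rewrite !mulgA.
  by rewrite rdV mulgA.
rewrite /commute 2!mulgA r2 -!mulgA; congr (_ * (_ * _)).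
have e : c m * (d * partial_prod c m)^-1 = (d * partial_prod c m)^-1 * c 0.
  apply: (@mulgI _ (d * partial_prod c m)); rewrite mulVKg mulgA.
  apply: (@mulIg _ (d * partial_prod c m)).
  rewrite mulgVK -(mulgA d) -[partial_prod c m * c m]/d.
  by rewrite dd !mulgA mulgV mul1g.
by move: e; rewrite invgM -!mulgA.
Qed.

(** * Generated subgroups and integer powers *)

Inductive generated (G : groupType) (S : set G) : G -> Prop :=
| generated1 : generated S 1
| generatedM x g : S x -> generated S g -> generated S (x * g)
| generatedV x g : S x -> generated S g -> generated S (x^-1 * g).

Section Generated.
Context (G : groupType) (S : set G).

Lemma generated_gen x : S x -> generated S x.
Proof. by move=> Sx; rewrite -[x]mulg1; apply/generatedM/generated1. Qed.

Lemma generated_mul g h : generated S g -> generated S h -> generated S (g * h).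
Proof.
move=> + Sh; elim=> [|x {}g Sx _ IH|x {}g Sx _ IH]; first by rewrite mul1g.
  by rewrite -mulgA; apply: generatedM.
by rewrite -mulgA; apply: generatedV.
Qed.

Lemma generated_inv g : generated S g -> generated S g^-1.
Proof.
elim=> [|x {}g Sx _ IH|x {}g Sx _ IH]; rewrite ?invg1 ?invgM ?invgK.
- exact: generated1.
- apply: generated_mul => //; rewrite -[x^-1]mulg1.
  exact/generatedV/generated1.
- by apply: generated_mul => //; apply: generated_gen.
Qed.

Lemma generated_conj a : (forall x, S x -> generated S (x ^ a)) ->
  forall g, generated S g -> generated S (g ^ a).
Proof.
move=> Sa g; elim=> [|x {}g Sx _ IH|x {}g Sx _ IH].
- by rewrite conj1g; apply: generated1.
- by rewrite conjMg; apply: generated_mul => //; apply: Sa.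
- by rewrite conjMg conjVg; apply: generated_mul => //; apply/generated_inv/Sa.
Qed.

End Generated.

Lemma generated_sub (G : groupType) (S T : set G) :
  (forall x, S x -> generated T x) -> forall g, generated S g -> generated T g.
Proof.
move=> ST g; elim=> [|x {}g Sx _ IH|x {}g Sx _ IH]; first exact: generated1.
  by apply: generated_mul => //; apply: ST.
by apply: generated_mul => //; apply/generated_inv/ST.
Qed.

Definition zpow (G : groupType) (g : G) (k : int) : G :=
  match k with Posz n => g ^+ n | Negz n => g ^- n.+1 end.

Section Zpow.
Context (G : groupType) (g : G).
Implicit Types k : int.

Lemma zpowS k : zpow g (k + 1)%R = g * zpow g k.
Proof.
case: k => [n|[|n]].
- by rewrite -PoszD addn1 /= expgS.
- by rewrite /= expg1 mulgV.
- have -> : (Negz n.+1 + 1 = Negz n)%R by lia.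
  by rewrite /= -!expVgn [in RHS]expgS mulVKg.
Qed.

Lemma zpowSr k : zpow g (k + 1)%R = zpow g k * g.
Proof.
case: k => [n|[|n]].
- by rewrite -PoszD addn1 /= expgSr.
- by rewrite /= expg1 mulVg.
- have -> : (Negz n.+1 + 1 = Negz n)%R by lia.
  by rewrite /= -!expVgn [in RHS]expgSr mulgVK.
Qed.

Lemma zpowPr k : zpow g (k - 1)%R = zpow g k * g^-1.
Proof. by rewrite -[k in RHS](GRing.subrK 1%R) zpowSr mulgK. Qed.

Lemma zpowP k : zpow g (k - 1)%R = g^-1 * zpow g k.
Proof. by rewrite -[k in RHS](GRing.subrK 1%R) zpowS mulKg. Qed.

Lemma int_step_ind (Q : int -> Prop) : Q 0%R ->
  (forall k, Q k -> Q (k + 1)%R) -> (forall k, Q k -> Q (k - 1)%R) ->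
  forall k, Q k.
Proof.
move=> Q0 QS QP; elim/int_ind => // n Qn.
  by rewrite -addn1 PoszD; apply: QS.
have -> : (- n.+1%:Z = - n%:Z - 1)%R by lia.
exact: QP.
Qed.

End Zpow.

Lemma zpow_hom (G H : groupType) (f : {multiplicative G -> H}) g k :
  f (zpow g k) = zpow (f g) k.
Proof. by case: k => n /=; rewrite ?homV homX. Qed.

(** * The loops of the strands and Artin's formulas *)

Section Loops.
Context (m : nat) (G : groupType) (s : nat -> G) (t : G).
Hypothesis st : annular m s t.

(** [loop i] carries strand [i] once around the core; the loops generate the
    free normal factor of the annular braid group. *)
Definition loop i := t ^ partial_prod s i.

Lemma loop0 : loop 0 = t. Proof. exact: conjg1. Qed.

Lemma loopS i : loop i.+1 = loop i ^ s i.
Proof. by rewrite /loop conjgM. Qed.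

Lemma loop_comm i j : j <= m -> i < j \/ (j.+1 < i /\ i <= m.+1) ->
  loop i ^ s j = loop i.
Proof.
move=> jm [ij|[ji im]]; rewrite /loop -conjgM.
  rewrite -(partial_prod_comm (ann_comm st)) // conjgM (@conj_commute _ t) //.
  by apply: (ann_comm_t st) => //; apply: leq_trans ij.
rewrite (partial_prod_shift (ann_comm st) (ann_brd st)) // conjgM.
rewrite (@conj_commute _ t) //; apply: (ann_comm_t st) => //.
by rewrite -ltnS; apply: leq_trans im.
Qed.

(** The pair [(loop j.+1, s j.+1)] is conjugate to [(loop j, s j)] under
    [s j.+1 * s j], so the relation between [t] and [s 0] propagates. *)
Lemma loop_quad j : j <= m -> commute (s j) (loop j * s j * loop j).
Proof.
elim: j => [_|j IH jm]; first by rewrite loop0; apply: (ann_quad st).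
have e1 : s j.+1 = s j ^ (s j.+1 * s j).
  apply: (@mulgI _ (s j.+1 * s j)); rewrite conjgE mulVKg mulgA.
  exact/esym/(ann_brd st).
have e2 : loop j.+1 = loop j ^ (s j.+1 * s j).
  by rewrite loopS [in RHS]conjgM (@loop_comm j j.+1) //; left.
rewrite e2 {1 3}e1 -!conjMg; apply/commute_conj/IH; exact: ltnW.
Qed.

Lemma loop_conjV j : j <= m -> loop j ^ (s j)^-1 = loop j.+1 ^ loop j.
Proof.
move=> jm; have /commute_sym/commuteV/commute_sym c := loop_quad jm.
rewrite loopS !conjgE invgK; apply: (@mulgI _ (loop j)); rewrite mulVKg.
by move: c; rewrite /commute !mulgA => ->.
Qed.

Lemma loop_conjS j : j <= m -> loop j.+1 ^ s j = loop j ^ (loop j.+1)^-1.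
Proof.
move=> jm; have /(congr1 (conjg^~ (s j))) := loop_conjV jm.
by rewrite conjgKV [RHS]conjJg -loopS => ->; rewrite conjgK.
Qed.

Definition loops : set G := [set g | exists2 i, i <= m.+1 & g = loop i].

Lemma loops_gen i : i <= m.+1 -> generated loops (loop i).
Proof. by move=> im; apply: generated_gen; exists i. Qed.

Lemma loops_conj g h : generated loops h -> generated loops g ->
  generated loops (g ^ h).
Proof.
move=> Fh Fg; rewrite conjgE.
by apply: generated_mul; [apply: generated_inv | apply: generated_mul].
Qed.

Lemma loops_conj_s j g : j <= m ->
  generated loops g -> generated loops (g ^ s j).
Proof.
move=> jm; apply: generated_conj => _ [i im ->].
have [->|ij] := eqVneq i j; first by rewrite -loopS; apply: loops_gen.
have [->|iSj] := eqVneq i j.+1.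
  rewrite loop_conjS //; apply: loops_conj; last by apply: loops_gen; lia.
  by apply/generated_inv/loops_gen.
by rewrite loop_comm //; [apply: loops_gen | lia].
Qed.

Lemma loops_conj_sV j g : j <= m ->
  generated loops g -> generated loops (g ^ (s j)^-1).
Proof.
move=> jm; apply: generated_conj => _ [i im ->].
have [->|ij] := eqVneq i j.
  by rewrite loop_conjV //; apply: loops_conj; apply: loops_gen; lia.
have [->|iSj] := eqVneq i j.+1.
  by rewrite loopS conjgK; apply: loops_gen; lia.
by rewrite -{1}(@loop_comm i j) ?conjgK //; [apply: loops_gen | lia].
Qed.

(** The Reidemeister-Schreier generators of the kernel of the total exponent
    on the free group of the loops, for the transversal of the powers of
    [t]. *)
Definition shifted_loop i k := (loop i.+1 * t^-1) ^ (zpow t k)^-1.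

Definition shifted_loops : set G :=
  [set g | exists i k, i <= m /\ g = shifted_loop i k].

Lemma shifted_loop_conjV i k : shifted_loop i k ^ t^-1 = shifted_loop i (k + 1)%R.
Proof. by rewrite /shifted_loop zpowS invgM conjgM. Qed.

Lemma shifted_loop_conj i k : shifted_loop i k ^ t = shifted_loop i (k - 1)%R.
Proof. by rewrite /shifted_loop zpowP invgM invgK conjgM. Qed.

Lemma shifted_loop0 i : shifted_loop i 0%R = loop i.+1 * t^-1.
Proof. by rewrite /shifted_loop /= invg1 conjg1. Qed.

Lemma shifted_loops_sub g : generated shifted_loops g -> generated loops g.
Proof.
have Ft : generated loops t by rewrite -loop0; apply: loops_gen.
apply: generated_sub => _ [i [k [im ->]]].
elim/int_step_ind: k => [|k|k].
- rewrite shifted_loop0.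
  by apply: generated_mul; [apply: loops_gen | apply: generated_inv].
- by move=> IH; rewrite -shifted_loop_conjV; apply/loops_conj/IH/generated_inv.
- by rewrite -shifted_loop_conj; apply: loops_conj.
Qed.

Lemma shifted_loops_conj g :
  generated shifted_loops g -> generated shifted_loops (g ^ t).
Proof.
apply: generated_conj => _ [i [k [im ->]]].
by rewrite shifted_loop_conj; apply: generated_gen; exists i, (k - 1)%R.
Qed.

Lemma shifted_loops_conjV g :
  generated shifted_loops g -> generated shifted_loops (g ^ t^-1).
Proof.
apply: generated_conj => _ [i [k [im ->]]].
by rewrite shifted_loop_conjV; apply: generated_gen; exists i, (k + 1)%R.
Qed.

(** Powers of [t] are a transversal: modulo the subgroup generated by the
    shifted loops, which [t] normalises, every loop equals [t]. *)
Lemma loops_shifted g : generated loops g ->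
  exists k, generated shifted_loops (g * zpow t k).
Proof.
have z0 i : i < m.+1 -> generated shifted_loops (loop i.+1 * t^-1).
  by move=> im; apply: generated_gen; exists i, 0%R; rewrite shifted_loop0.
elim=> [|x {}g [i im ->] _ [k IH]|x {}g [i im ->] _ [k IH]].
- by exists 0%R; rewrite mulg1; apply: generated1.
- exists (k - 1)%R.
  have IH' : generated shifted_loops (t * g * zpow t (k - 1)%R).
    rewrite (_ : _ * _ = (g * zpow t k) ^ t^-1); first exact: shifted_loops_conjV.
    by rewrite conjgE invgK zpowPr !mulgA.
  case: i im => [_|i im]; first by rewrite loop0.
  have := generated_mul (z0 i im) IH'.
  by rewrite !mulgA mulgVK.
- exists (k + 1)%R.
  have conj h : generated shifted_loops (h * zpow t k) ->
      generated shifted_loops (t^-1 * h * zpow t (k + 1)%R).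
    move/shifted_loops_conj; rewrite (_ : _ ^ t = t^-1 * h * zpow t (k + 1)%R) //.
    by rewrite conjgE zpowSr !mulgA.
  case: i im => [_|i im]; first by rewrite loop0; apply: conj.
  have := generated_mul (generated_inv (z0 i im)) IH.
  by rewrite mulgA => /conj; rewrite invgM invgK !mulgA mulVg mul1g.
Qed.

End Loops.

(** * The annular braid group *)

Inductive annular_rel (m : nat) :
    word (option 'I_m.+1) -> word (option 'I_m.+1) -> Prop :=
| annular_rel_comm (i j : 'I_m.+1) : i.+1 < j ->
    annular_rel [seq gen_letter k | k <- [:: Some i; Some j]]
                [seq gen_letter k | k <- [:: Some j; Some i]]
| annular_rel_brd (i j : 'I_m.+1) : i.+1 = j ->
    annular_rel [seq gen_letter k | k <- [:: Some i; Some j; Some i]]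
                [seq gen_letter k | k <- [:: Some j; Some i; Some j]]
| annular_rel_comm_t (i : 'I_m.+1) : 0 < i ->
    annular_rel [seq gen_letter k | k <- [:: None; Some i]]
                [seq gen_letter k | k <- [:: Some i; None]]
| annular_rel_quad (i : 'I_m.+1) : i = 0 :> nat ->
    annular_rel [seq gen_letter k | k <- [:: Some i; None; Some i; None]]
                [seq gen_letter k | k <- [:: None; Some i; None; Some i]].

Definition annular_braid (m : nat) : groupType := presented (@annular_rel m).

(** Indexed by natural numbers to be an [annular] family; [inord] sends the
    indices above [m] to the default value 0. *)
Definition ann_s (m : nat) (i : nat) : annular_braid m :=
  pres_gen (@annular_rel m) (Some (inord i)).

Definition ann_t (m : nat) : annular_braid m := pres_gen (@annular_rel m) None.

Lemma annular_braidP (m : nat) : annular m (@ann_s m) (ann_t m).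
Proof.
have rel u v : @annular_rel m u v ->
    pres_class (@annular_rel m) u = pres_class (@annular_rel m) v.
  by move=> uv; apply/pres_classP/cong_rel.
split.
- move=> i j ij jm.
  have /annular_rel_comm/rel :
    ((inord i : 'I_m.+1).+1 < (inord j : 'I_m.+1))%N by rewrite !inordK //; lia.
  by rewrite !pres_class_gens !big_cons !big_nil !mulg1.
- move=> i im.
  have /annular_rel_brd/rel :
    ((inord i : 'I_m.+1).+1 = (inord i.+1 : 'I_m.+1))%N by rewrite !inordK //; lia.
  by rewrite !pres_class_gens !big_cons !big_nil !mulg1 !mulgA.
- move=> i i0 im.
  have /annular_rel_comm_t/rel : (0 < (inord i : 'I_m.+1))%N by rewrite inordK.
  by rewrite !pres_class_gens !big_cons !big_nil !mulg1.
- have /annular_rel_quad/rel : (inord 0 : 'I_m.+1) = 0%N :> nat by rewrite inordK.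
  by rewrite !pres_class_gens !big_cons !big_nil !mulg1 /commute !mulgA.
Qed.

Section AnnularLift.
Context (m : nat) (G : groupType) (s : nat -> G) (t : G).
Hypothesis st : annular m s t.

Let gens (x : option 'I_m.+1) : G := if x is Some i then s i else t.

Lemma annular_lift_rel u v :
  annular_rel u v -> word_eval gens u = word_eval gens v.
Proof.
case=> {u v}; rewrite /word_eval.
- move=> i j ij; rewrite !big_cons !big_nil /= !mulg1.
  by apply: (ann_comm st) => //; rewrite -ltnS.
- move=> i j ij; rewrite !big_cons !big_nil /= !mulg1 !mulgA -ij.
  by apply: (ann_brd st); rewrite -ltnS ij.
- move=> i i0; rewrite !big_cons !big_nil /= !mulg1.
  by apply: (ann_comm_t st) => //; rewrite -ltnS.
- move=> i i0; rewrite !big_cons !big_nil /= !mulg1 i0.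
  by have := ann_quad st; rewrite /commute !mulgA.
Qed.

Definition annular_lift : {multiplicative annular_braid m -> G} :=
  pres_lift annular_lift_rel.

Lemma annular_lift_s i : i <= m -> annular_lift (ann_s m i) = s i.
Proof.
move=> im; apply: etrans (pres_lift_gen annular_lift_rel _) _.
by rewrite /= inordK.
Qed.

Lemma annular_lift_t : annular_lift (ann_t m) = t.
Proof. exact: pres_lift_gen. Qed.

End AnnularLift.

Lemma annular_braid_ind m (Q : annular_braid m -> Prop) : Q 1 ->
    (forall i g, i <= m -> Q g -> Q (ann_s m i * g)) ->
    (forall i g, i <= m -> Q g -> Q ((ann_s m i)^-1 * g)) ->
    (forall g, Q g -> Q (ann_t m * g)) ->
    (forall g, Q g -> Q ((ann_t m)^-1 * g)) ->
  forall g, Q g.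
Proof.
move=> Q1 Qs QsV Qt QtV; apply: presented_ind => //.
  move=> [i|] g Qg; last exact: Qt.
  by rewrite -[i]inord_val; apply: Qs; rewrite // -ltnS.
move=> [i|] g Qg; last exact: QtV.
by rewrite -[i]inord_val; apply: QsV; rewrite // -ltnS.
Qed.

Lemma loops_normal m (g h : annular_braid m) :
  generated (loops m (@ann_s m) (ann_t m)) g ->
  generated (loops m (@ann_s m) (ann_t m)) (g ^ h).
Proof.
have st := annular_braidP m.
have Ft : generated (loops m (@ann_s m) (ann_t m)) (ann_t m).
  by rewrite -{2}(loop0 (@ann_s m) (ann_t m)); apply: loops_gen.
elim/annular_braid_ind: h g => [g|i h im IH g|i h im IH g|h IH g|h IH g] Fg;
  rewrite ?conjg1 // conjgM; apply: IH.
- exact: loops_conj_s.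
- exact: loops_conj_sV.
- exact: loops_conj.
- exact/loops_conj/Fg/generated_inv.
Qed.

(** * The winding number and the normality of the shifted loops *)

(** The integers, acting on themselves by translation, as a group of
    bijections. *)
Definition int_shift : sym int :=
  Sym (GRing.addrK (1%R : int)) (GRing.subrK (1%R : int)).

Lemma int_shift_zpow k : zpow int_shift k 0%R = k.
Proof.
elim/int_step_ind: k => // k IH.
  by rewrite zpowS sym_mulE IH.
by rewrite zpowP sym_mulE IH.
Qed.

Lemma winding_annular m : annular m (fun=> 1) int_shift.
Proof.
by split=> *; rewrite /brd /commute ?(mulg1, mul1g).
Qed.

Definition winding m : {multiplicative annular_braid m -> sym int} :=
  annular_lift (winding_annular m).

(** If [f t] commutes with the [f (s i)], all loops have the same image as [t].
    This applies to the winding number and to the map that forgets [t]. *)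
Lemma shifted_loops_ker m (G K : groupType) (s : nat -> G) (t : G)
    (f : {multiplicative G -> K}) (g : G) :
  (forall i, i <= m -> commute (f t) (f (s i))) ->
  generated (shifted_loops m s t) g -> f g = 1.
Proof.
move=> fC; have f_loop i : i <= m.+1 -> f (loop s t i) = f t.
  move=> im; rewrite homJ conj_commute // partial_prod_hom.
  elim: i im => [|i IH] im /=; first exact: commute1.
  by apply: commuteM; [apply/IH/ltnW | apply: fC].
have f_shifted i k : i <= m -> f (shifted_loop s t i k) = 1.
  by move=> im; rewrite homJ gmulfM homV f_loop // mulgV conj1g.
elim=> [|_ h [i [k [im ->]]] _ IH|_ h [i [k [im ->]]] _ IH]; first exact: hom1.
  by rewrite gmulfM f_shifted // mul1g.
by rewrite gmulfM homV f_shifted // invg1 mul1g.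
Qed.

(** A conjugate of a product of shifted loops is a product of loops, hence a
    product of shifted loops times a power of [t]; the winding number shows that
    this power is trivial. *)
Lemma shifted_loops_normal m (g h : annular_braid m) :
  generated (shifted_loops m (@ann_s m) (ann_t m)) g ->
  generated (shifted_loops m (@ann_s m) (ann_t m)) (g ^ h).
Proof.
have ker := @shifted_loops_ker m _ _ (@ann_s m) (ann_t m) (winding m).
have {}ker x : generated (shifted_loops m (@ann_s m) (ann_t m)) x ->
    winding m x = 1.
  by apply: ker => i im; rewrite annular_lift_s //; apply: commute1.
move=> Pg; have /loops_shifted[k Pk] := loops_normal h (shifted_loops_sub Pg).
suff k0 : k = 0%R by move: Pk; rewrite k0 mulg1.
have := ker _ Pk.
rewrite gmulfM homJ (ker _ Pg) conj1g mul1g zpow_hom annular_lift_t.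
by move=> /(congr1 (fun f : sym int => f 0%R)); rewrite int_shift_zpow.
Qed.

(** * The affine braid group and its rotation *)

(** All the generators as one periodic family: the index [m.+1] gives the
    generator [a], for which [insub] returns [None]. *)
Definition aff_gen (m : nat) (i : nat) : braid_affA m.+1 :=
  pres_gen (@affine_rel m.+1) (insub (i %% m.+2)).

Section AffineLift.
Context (m : nat).

Lemma aff_gen_s i (im : i < m.+1) : aff_gen m i = aff_sigma (Ordinal im).
Proof.
by rewrite /aff_gen modn_small ?insubT // ltnW.
Qed.

Lemma aff_gen_a : aff_gen m m.+1 = aff_a m.+1.
Proof. by rewrite /aff_gen modn_small // insubF // ltnn. Qed.

Lemma aff_gen_per i : aff_gen m (i + m.+2) = aff_gen m i.
Proof. by rewrite /aff_gen modnDr. Qed.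

Lemma aff_gen_modD i d : aff_gen m (i + d) = aff_gen m (i %% m.+2 + d).
Proof. by rewrite /aff_gen modnDml. Qed.

Lemma aff_gen_mod i : aff_gen m i = aff_gen m (i %% m.+2).
Proof. by rewrite /aff_gen modn_mod. Qed.

Lemma aff_gen_modS i : aff_gen m i.+1 = aff_gen m (i %% m.+2).+1.
Proof. by have := aff_gen_modD i 1; rewrite !addn1. Qed.

Lemma pres_gen_aff (x : option 'I_m.+1) :
  pres_gen (@affine_rel m.+1) x = aff_gen m (if x is Some i then i : nat else m.+1).
Proof.
by case: x => [[i im]|]; rewrite ?aff_gen_a // aff_gen_s.
Qed.

(** Reduction of the indices modulo [m.+2] gives back the defining relations:
    the pairs of residues [(m, m.+1)] and [(m.+1, 0)] yield the two braid
    relations with [a]. *)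
Lemma aff_gen_cyclic : cyclic_affine m (aff_gen m).
Proof.
have rel u v : @affine_rel m.+1 u v ->
    pres_class (@affine_rel m.+1) u = pres_class (@affine_rel m.+1) v.
  by move=> uv; apply/pres_classP/cong_rel.
have comm i j : i < j -> j < m.+2 -> i.+1 < j -> j < i + m.+1 ->
    commute (aff_gen m i) (aff_gen m j).
  move=> ij jm ij2 jim; have im : i < m.+1 by lia.
  have [jSm|jSm] := ltnP j m.+1.
    rewrite !aff_gen_s.
    have /affine_comm/rel : (Ordinal im).+2 <= (Ordinal jSm) \/
      (Ordinal jSm).+2 <= (Ordinal im) by left.
    by rewrite !pres_class_gens !big_cons !big_nil !mulg1.
  have -> : j = m.+1 by lia.
  rewrite aff_gen_s aff_gen_a.
  have [i0 iSm] : 0 < (Ordinal im) /\ (Ordinal im).+1 < m.+1 by rewrite /=; lia.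
  have /rel := affine_comm_a i0 iSm.
  by rewrite !pres_class_gens !big_cons !big_nil !mulg1.
split=> [|m0 i|i d d1 dm]; first exact: aff_gen_per.
  rewrite aff_gen_modS aff_gen_mod.
  have := ltn_pmod i (isT : 0 < m.+2); move: (i %% m.+2) => {}i.
  have m2 : 1 < m.+1 by [].
  rewrite ltnS leq_eqVlt => /predU1P[->|].
    rewrite aff_gen_a -[m.+2]add0n aff_gen_per (aff_gen_s (isT : 0 < m.+1)).
    have /rel := @affine_braid_first m.+1 (Ordinal (isT : 0 < m.+1)) m2 erefl.
    by rewrite !pres_class_gens !big_cons !big_nil !mulg1 /brd !mulgA.
  move=> im; rewrite (aff_gen_s im).
  have : i <= m by []; rewrite leq_eqVlt => /predU1P[iE|iSm].
    have -> : aff_gen m i.+1 = aff_a m.+1 by rewrite iE aff_gen_a.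
    have /rel := @affine_braid_last m.+1 (Ordinal im) m2 (congr1 S iE).
    by rewrite !pres_class_gens !big_cons !big_nil !mulg1 /brd !mulgA.
  rewrite -ltnS in iSm; rewrite (aff_gen_s iSm).
  have /affine_braid/rel : ((Ordinal im).+1 = (Ordinal iSm))%N by [].
  by rewrite !pres_class_gens !big_cons !big_nil !mulg1 /brd !mulgA.
rewrite aff_gen_modD aff_gen_mod.
have := ltn_pmod i (isT : 0 < m.+2); move: (i %% m.+2) => {}i im.
have [id|id] := ltnP (i + d) m.+2; first by apply: comm; lia.
have -> : (i + d = (i + d - m.+2) + m.+2)%N by lia.
by rewrite aff_gen_per; apply/commute_sym/comm; lia.
Qed.

Section Lift.
Context (G : groupType) (c : nat -> G).
Hypothesis cc : cyclic_affine m c.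

Let gens (x : option 'I_m.+1) : G := c (if x is Some i then i : nat else m.+1).

Lemma affine_lift_rel u v :
  affine_rel u v -> word_eval gens u = word_eval gens v.
Proof.
have comm i j : i.+1 < j -> j <= m.+1 -> j < i + m.+1 -> commute (c i) (c j).
  move=> ij jm jim; have -> : (j = i + (j - i))%N by lia.
  by apply: (cyc_comm cc); lia.
case=> {u v}; rewrite /word_eval.
- move=> i j ij; rewrite !big_cons !big_nil /gens /= !mulg1.
  have := ltn_ord i; have := ltn_ord j.
  by case: ij => ij jm im; [|apply: commute_sym]; apply: comm; lia.
- move=> i j ij; rewrite !big_cons !big_nil /gens /= !mulg1 !mulgA -ij.
  apply: (cyc_brd cc); have := ltn_ord j; lia.
- move=> i i0 im; rewrite !big_cons !big_nil /gens /= !mulg1.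
  by apply: comm; lia.
- move=> i m2 i0; rewrite !big_cons !big_nil /gens /= !mulg1 !mulgA i0.
  have e : c m.+2 = c 0 := cyc_per cc 0.
  by rewrite -e; apply/esym/(cyc_brd cc).
- move=> i m2 [im]; rewrite !big_cons !big_nil /gens /= !mulg1 !mulgA im.
  by apply: (cyc_brd cc).
Qed.

Definition affine_lift : {multiplicative braid_affA m.+1 -> G} :=
  pres_lift affine_lift_rel.

Lemma affine_lift_gen i : affine_lift (aff_gen m i) = c i.
Proof.
have step j : c (j %% m.+2) = c j.
  rewrite [in RHS](divn_eq j m.+2); elim: (j %/ m.+2) => // q ->.
  by rewrite mulSnr addnAC (cyc_per cc).
apply: etrans (pres_lift_gen affine_lift_rel _) _; rewrite -[RHS]step.
congr c; case: insubP => [u _ -> //|].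
by have := ltn_pmod i (isT : 0 < m.+2); lia.
Qed.

End Lift.

Lemma affine_hom_ext (G : groupType)
    (f g : {multiplicative braid_affA m.+1 -> G}) :
  (forall i, f (aff_gen m i) = g (aff_gen m i)) -> f =1 g.
Proof. by move=> fg; apply: presented_hom_ext => x; rewrite pres_gen_aff. Qed.

Lemma cyclic_shift (G : groupType) (c : nat -> G) j :
  cyclic_affine m c -> cyclic_affine m (fun i => c (j + i)%N).
Proof.
move=> cc; split=> [i|m0 i|i d d1 dm]; first by rewrite addnA (cyc_per cc).
  by rewrite addnS; apply: (cyc_brd cc).
by rewrite addnA; apply: (cyc_comm cc).
Qed.

Definition aff_rot j : {multiplicative braid_affA m.+1 -> braid_affA m.+1} :=
  affine_lift (cyclic_shift j aff_gen_cyclic).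

Lemma aff_rot_gen j i : aff_rot j (aff_gen m i) = aff_gen m (j + i).
Proof. exact: affine_lift_gen. Qed.

Lemma aff_rotK i j : (i + j = m.+2)%N -> cancel (aff_rot i) (aff_rot j).
Proof.
move=> ij g; elim/presented_ind: g => [|x g IH|x g IH].
- by rewrite !hom1.
- rewrite pres_gen_aff !gmulfM IH !aff_rot_gen.
  by rewrite addnA (addnC j) ij addnC aff_gen_per.
- rewrite pres_gen_aff !gmulfM !homV IH !aff_rot_gen.
  by rewrite addnA (addnC j) ij addnC aff_gen_per.
Qed.

Definition aff_rot_sym : sym (braid_affA m.+1) :=
  Sym (aff_rotK (add1n m.+1)) (aff_rotK (addn1 m.+1)).

Lemma hom_cyclic (G K : groupType) (f : {multiplicative G -> K}) (c : nat -> G) :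
  cyclic_affine m c -> cyclic_affine m (f \o c).
Proof.
move=> cc; split=> [i|m0 i|i d d1 dm] /=; first by rewrite (cyc_per cc).
  by rewrite /brd -!gmulfM (cyc_brd cc).
by apply/gmulf_commute/(cyc_comm cc).
Qed.

(** * The embedding into the annular braid group *)

Definition aff_emb : {multiplicative braid_affA m.+1 -> annular_braid m} :=
  affine_lift (rotated_cyclic (annular_braidP m)).

Lemma aff_emb_gen i : aff_emb (aff_gen m i) = rotated m (ann_s m) (ann_t m) i.
Proof. exact: affine_lift_gen. Qed.

(** On the set of elements of the affine braid group, the rotation of the
    generators and the left translations satisfy the annular relations. *)
Lemma regular_annular : annular m (@translation (braid_affA m.+1) \o aff_gen m)
  (aff_rot_sym * (partial_prod (@translation _ \o aff_gen m) m.+1)^-1).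
Proof.
apply: annular_of_rotation; first exact: (hom_cyclic _ aff_gen_cyclic).
move=> i; rewrite [LHS]translation_conj; last exact: gmulfM.
by rewrite /= aff_rot_gen.
Qed.

(** The action of the annular braid group on the affine one restricts to the
    left regular action, which is faithful. *)
Lemma aff_emb_inj : injective aff_emb.
Proof.
pose reg : {multiplicative annular_braid m -> sym (braid_affA m.+1)} :=
  annular_lift regular_annular.
have reg_s i : i <= m -> reg (ann_s m i) = translation (aff_gen m i).
  by move=> im; rewrite /reg annular_lift_s.
have reg_rot : reg (rotation m (ann_s m) (ann_t m)) = aff_rot_sym.
  rewrite /rotation gmulfM partial_prod_hom annular_lift_t.
  rewrite (eq_partial_prod (s' := @translation _ \o aff_gen m)) ?mulgVK //.
have rot_gen i : aff_rot_sym * translation (aff_gen m i) =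
    translation (aff_gen m i.+1) * aff_rot_sym.
  by rewrite [LHS]translation_conj /= ?aff_rot_gen //; apply: gmulfM.
have regE : reg \o aff_emb =1 @translation (braid_affA m.+1).
  apply: (affine_hom_ext (f := reg \o aff_emb)) => i.
  rewrite -[LHS]/(reg (aff_emb _)) aff_emb_gen; elim: i => [|i IH].
    by rewrite rotated_s ?reg_s //; apply: annular_braidP.
  rewrite rotatedS homJ homV reg_rot IH conjgE invgK mulgA.
  by rewrite rot_gen mulgK.
move=> g h gh; have := regE h; rewrite /= -gh.
move/(etrans (esym (regE g))) => /(congr1 (fun f : sym _ => f 1)).
by rewrite /= !mulg1.
Qed.

End AffineLift.

(** * The kernel of the projection to the braid group *)

Lemma tail_conj_prod (G : groupType) (m : nat) (n_gt0 : (0 < m.+1)%N)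
    (s : 'I_m.+1 -> G) (c : nat -> G) : (forall i, s i = c i) ->
  tail_conj n_gt0 s = c 0 ^ partial_prod c m.+1.
Proof.
move=> sc; have sE i : i < m.+1 -> nat_family s i = c i.
  by move=> im; rewrite -[i]/(val (Ordinal im)) nat_familyE sc.
have iterE k : tail_iter (nat_family s) k =
    nat_family s 0 ^ partial_prod (nat_family s) k.+1.
  elim: k => [|k IH]; first by rewrite /= mul1g conjgE mulKg.
  by rewrite -[LHS]/(tail_iter _ k ^ _) IH -conjgM.
by rewrite tail_conjE iterE sE // (eq_partial_prod sE).
Qed.

Section Projection.
Context (m : nat).

Definition nat_sigma (i : nat) : braid_A m.+1 := sigma (inord i : 'I_m.+1).

Lemma braid_annular : annular m nat_sigma 1.
Proof.
split=> [i j ij jm|i im|i _ _|]; rewrite /commute ?mul1g ?mulg1 //.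
  by apply: sigma_comm; left; rewrite !inordK //; lia.
by apply: sigma_braid; rewrite !inordK //; lia.
Qed.

(** Forgetting the core of the annulus sends [t] to the identity. *)
Definition ann_proj : {multiplicative annular_braid m -> braid_A m.+1} :=
  annular_lift braid_annular.

Context (n_gt0 : 0 < m.+1).

Lemma aff_emb_e :
  aff_emb m (aff_e n_gt0) = (shifted_loop (ann_s m) (ann_t m) m 0%R)^-1.
Proof.
rewrite /aff_e (tail_conj_prod _ (c := aff_gen m)) => [|i]; last first.
  exact: (pres_gen_aff (Some i)).
have st := annular_braidP m.
rewrite gmulfM homV -aff_gen_a homJ partial_prod_hom !aff_emb_gen.
rewrite (rotated_s st (leq0n m)).
rewrite (eq_partial_prod (s' := ann_s m)) => [|i im]; last first.
  by rewrite -(rotated_s st) // -aff_emb_gen.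
by rewrite rotated_last_conj // shifted_loop0.
Qed.

Lemma beta_e : beta n_gt0 (aff_e n_gt0) = 1.
Proof.
rewrite /aff_e (tail_conj_prod _ (c := aff_gen m)) => [|i]; last first.
  exact: (pres_gen_aff (Some i)).
rewrite gmulfM homV beta_a homJ partial_prod_hom.
rewrite (tail_conj_prod _ (c := beta n_gt0 \o aff_gen m)) ?mulVg //.
by move=> i; rewrite /= -(pres_gen_aff (Some i)) beta_sigma.
Qed.

(** Both maps agree on the [sigma i] and kill [e], which together generate. *)
Lemma ann_proj_emb : ann_proj \o aff_emb m =1 beta n_gt0.
Proof.
have sigE (i : 'I_m.+1) : ann_proj (aff_emb m (aff_sigma i)) = sigma i.
  have im : i <= m by rewrite -ltnS.
  have st := annular_braidP m.
  rewrite [aff_sigma i](pres_gen_aff (Some i)) aff_emb_gen (rotated_s st) //.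
  by rewrite annular_lift_s // /nat_sigma inord_val.
apply: (presented_hom_ext (f := ann_proj \o aff_emb m)) => -[i|].
  by rewrite [RHS]beta_sigma; apply: sigE.
have aE : aff_a m.+1 = tail_conj n_gt0 (@aff_sigma m.+1) * (aff_e n_gt0)^-1.
  by rewrite /aff_e invgM invgK mulVKg.
rewrite -[pres_gen _ None]/(aff_a m.+1) aE (tail_conj_prod _ (c := aff_gen m));
  last by move=> i; exact: (pres_gen_aff (Some i)).
have f_s i : i < m.+1 ->
    ann_proj (aff_emb m (aff_gen m i)) = beta n_gt0 (aff_gen m i).
  by move=> im; rewrite aff_gen_s beta_sigma sigE.
rewrite -[LHS]/(ann_proj (aff_emb m _)) 2![in LHS]gmulfM [RHS]gmulfM.
rewrite !homV beta_e.
have -> : ann_proj (aff_emb m (aff_e n_gt0)) = 1.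
  rewrite aff_emb_e shifted_loop0 homV gmulfM homV homJ annular_lift_t.
  by rewrite conj1g invg1 mulg1 invg1.
rewrite !homJ !partial_prod_hom f_s //; congr (_ ^ _ * _).
exact: eq_partial_prod.
Qed.

Lemma aff_sigma_section :
  exists f : {multiplicative braid_A m.+1 -> braid_affA m.+1},
    forall i, f (sigma i) = aff_sigma i.
Proof.
have rel u v : braid_rel u v ->
    word_eval (@aff_sigma m.+1) u = word_eval (@aff_sigma m.+1) v.
  have arel u' v' : @affine_rel m.+1 u' v' ->
    pres_class (@affine_rel m.+1) u' = pres_class (@affine_rel m.+1) v'.
    by move=> uv; apply/pres_classP/cong_rel.
  case=> {u v}; rewrite /word_eval => i j ij; rewrite !big_cons !big_nil /= !mulg1.
    have /arel := affine_comm ij.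
    by rewrite !pres_class_gens !big_cons !big_nil !mulg1.
  have /arel := affine_braid ij.
  by rewrite !pres_class_gens !big_cons !big_nil !mulg1.
by exists (pres_lift rel : {multiplicative _ -> _}) => i; apply: pres_lift_gen.
Qed.

Lemma beta_surj : range (beta n_gt0) = [set: braid_A m.+1].
Proof.
apply/seteqP; split=> // b _; have [f fs] := aff_sigma_section.
exists (f b) => //; elim/presented_ind: b => [|x g IH|x g IH].
- by rewrite !hom1.
- by rewrite !gmulfM IH -/(sigma x) fs beta_sigma.
- by rewrite !gmulfM !homV IH -/(sigma x) fs beta_sigma.
Qed.

Lemma normal_closure_normal (G : groupType) (S : set G) :
  normal_subgroup (normal_closure S).
Proof.
split=> [H [[? _ _ _] _] //|x y Hx Hy|x Hx|x g Hx] H HS;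
  move: (HS) => [[_ HM HV HJ] _].
- by apply: HM; [apply: Hx | apply: Hy].
- exact: HV (Hx H HS).
- exact: HJ (Hx H HS).
Qed.

Lemma morph_ker_normal (G H : groupType) (f : {multiplicative G -> H}) :
  normal_subgroup (morph_ker f).
Proof.
rewrite /morph_ker; split=> /= [|x y xK yK|x xK|x g xK]; first exact: hom1.
- by rewrite gmulfM xK yK mulg1.
- by rewrite homV xK invg1.
- by rewrite homJ xK conj1g.
Qed.

(** The [sigma i] span a section [f] of [beta]; modulo the normal closure of [e]
    the generator [a] lies in its image, so every element [h] is congruent to
    [f (beta h)]. *)
Lemma normal_closure_beta :
  normal_closure [set aff_e n_gt0] = morph_ker (beta n_gt0).
Proof.
apply/seteqP; split=> [g|g gK].
  apply; split; last by move=> _ ->; exact: beta_e.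
  exact: morph_ker_normal.
have [N1 NM NV NJ] := normal_closure_normal [set aff_e n_gt0].
have Ne : normal_closure [set aff_e n_gt0] (aff_e n_gt0) by move=> H [_]; apply.
have [f fs] := aff_sigma_section.
(* for [h] in the kernel this says that [h] itself lies in the closure *)
suff key h : normal_closure [set aff_e n_gt0] (h * (f (beta n_gt0 h))^-1).
  by have := key g; rewrite gK hom1 invg1 mulg1.
pose Q x := normal_closure [set aff_e n_gt0] (x * (f (beta n_gt0 x))^-1).
have QM x y : Q x -> Q y -> Q (x * y).
  move=> Qx Qy; rewrite /Q !gmulfM invgM.
  have := NM _ _ (NJ _ x^-1 Qy) Qx.
  by rewrite conjgE invgK -!mulgA mulKg.
have QV x : Q x -> Q x^-1.
  move=> Qx; rewrite /Q !homV invgK.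
  by have := NJ _ x (NV _ Qx); rewrite conjgE invgM invgK -!mulgA mulVg mulg1.
have Qgen x : Q (pres_gen (@affine_rel m.+1) x).
  have Qs i : Q (aff_sigma i) by rewrite /Q beta_sigma fs mulgV.
  case: x => [i|]; first exact: Qs.
  have -> : pres_gen (@affine_rel m.+1) None =
      tail_conj n_gt0 (@aff_sigma m.+1) * (aff_e n_gt0)^-1.
    by rewrite /aff_e invgM invgK mulVKg.
  apply: (QM); last by apply: QV; rewrite /Q beta_e hom1 invg1 mulg1.
  rewrite (tail_conj_prod _ (c := aff_gen m));
    last by move=> i; exact: (pres_gen_aff (Some i)).
  have Qc i : i < m.+1 -> Q (aff_gen m i) by move=> im; rewrite aff_gen_s.
  have Qp k : k <= m.+1 -> Q (partial_prod (aff_gen m) k).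
    elim: k => [|k IH] km; first by rewrite /Q !hom1 mulgV.
    by rewrite [partial_prod _ _]/=; apply: (QM _ _ (IH (ltnW km)) (Qc _ km)).
  exact: QM _ _ (QV _ (Qp _ (leqnn _))) (QM _ _ (Qc 0 isT) (Qp _ (leqnn _))).
rewrite -/(Q h); move: h; apply: presented_ind => [|x h IH|x h IH].
- by rewrite /Q !hom1 mulgV.
- exact: QM.
- by apply: (QM); [apply: QV|].
Qed.

End Projection.

(** * The Artin representation *)

Local Notation x_ := (@free_gen nat).

(** Written so that [artin j] acts on [x_ i] as conjugation by [(s j)^-1] acts
    on [loop i]. *)
Definition artin (j : nat) : {multiplicative free_group nat -> free_group nat} :=
  free_lift (fun i => if i == j then x_ j.+1 ^ x_ j else
                      if i == j.+1 then x_ j else x_ i).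

Definition artinV (j : nat) : {multiplicative free_group nat -> free_group nat} :=
  free_lift (fun i => if i == j then x_ j.+1 else
                      if i == j.+1 then x_ j ^ (x_ j.+1)^-1 else x_ i).

Lemma artin_l j : artin j (x_ j) = x_ j.+1 ^ x_ j.
Proof. by rewrite free_lift_gen eqxx. Qed.
Lemma artin_r j : artin j (x_ j.+1) = x_ j.
Proof. by rewrite free_lift_gen eqxx ifN // neq_ltn ltnSn orbT. Qed.
Lemma artin_id i j : i != j -> i != j.+1 -> artin j (x_ i) = x_ i.
Proof. by move=> ij ijS; rewrite free_lift_gen !ifN. Qed.

Lemma artinK j : cancel (artin j) (artinV j).
Proof.
apply: (free_hom_ext (f := artinV j \o artin j) (g := idfun)) => i.
rewrite -[LHS]/(artinV j (artin j _)) -[RHS]/(x_ i) [artin j _]free_lift_gen.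
have [->|ij] := eqVneq i j.
  by rewrite homJ !free_lift_gen !eqxx ifN ?conjgKV //; lia.
have [->|iSj] := eqVneq i j.+1; first by rewrite free_lift_gen eqxx.
by rewrite free_lift_gen !ifN.
Qed.

Lemma artinVK j : cancel (artinV j) (artin j).
Proof.
apply: (free_hom_ext (f := artin j \o artinV j) (g := idfun)) => i.
rewrite -[LHS]/(artin j (artinV j _)) -[RHS]/(x_ i) [artinV j _]free_lift_gen.
have [->|ij] := eqVneq i j; first exact: artin_r.
have [->|iSj] := eqVneq i j.+1; last exact: artin_id.
by rewrite homJ homV artin_l artin_r conjgK.
Qed.

Definition artin_sym j : sym (free_group nat) := Sym (@artinK j) (@artinVK j).

Lemma artin_brd j : brd (artin_sym j) (artin_sym j.+1).
Proof.
apply: sym_ext.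
apply: (free_hom_ext (f := artin j \o (artin j.+1 \o artin j))
                     (g := artin j.+1 \o (artin j \o artin j.+1))) => i.
rewrite -[LHS]/(artin j (artin j.+1 (artin j _))).
rewrite -[RHS]/(artin j.+1 (artin j (artin j.+1 _))).
have L : artin j.+1 (x_ j) = x_ j by apply: artin_id; lia.
have R : artin j (x_ j.+2) = x_ j.+2 by apply: artin_id; lia.
have [->|i0] := eqVneq i j.
  by rewrite !(artin_l, artin_r, homJ, L, R) -conjJg.
have [->|i1] := eqVneq i j.+1.
  by rewrite !(artin_l, artin_r, homJ, L, R).
have [->|i2] := eqVneq i j.+2.
  by rewrite R !(artin_l, artin_r, homJ, L, R).
by rewrite !artin_id.
Qed.

Lemma artin_comm i j : i.+1 < j -> commute (artin_sym i) (artin_sym j).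
Proof.
move=> ij; apply: sym_ext.
apply: (free_hom_ext (f := artin i \o artin j) (g := artin j \o artin i)) => k.
rewrite -[LHS]/(artin i (artin j _)) -[RHS]/(artin j (artin i _)).
have [a b] : artin i (x_ j) = x_ j /\ artin i (x_ j.+1) = x_ j.+1.
  by split; apply: artin_id; lia.
have [c d] : artin j (x_ i) = x_ i /\ artin j (x_ i.+1) = x_ i.+1.
  by split; apply: artin_id; lia.
have [->|ki] := eqVneq k i; first by rewrite !(artin_l, c, d, homJ).
have [->|kiS] := eqVneq k i.+1; first by rewrite !(artin_r, c, d, homJ).
have [->|kj] := eqVneq k j; first by rewrite !(artin_l, a, b, homJ).
have [->|kjS] := eqVneq k j.+1; first by rewrite !(artin_r, a, b, homJ).
by rewrite !artin_id.
Qed.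

Lemma artin_annular m : annular m artin_sym (translation (x_ 0)).
Proof.
have tr j g : artin_sym j * translation g = translation (artin j g) * artin_sym j.
  by rewrite [LHS]translation_conj //; apply: gmulfM.
split=> [i j ij _|i _|i i0 _|]; first exact: artin_comm.
- exact: artin_brd.
- by apply/commute_sym; rewrite /commute tr artin_id //; lia.
have e : translation (x_ 0) * artin_sym 0 * translation (x_ 0) =
    translation (x_ 1%N * x_ 0) * artin_sym 0.
  rewrite -mulgA tr artin_l mulgA -gmulfM; congr (translation _ * _).
  by rewrite conjgE mulVKg.
by rewrite e /commute mulgA tr gmulfM artin_l artin_r conjgE mulVKg.
Qed.

(** The annular braid group acts on the free group of the loops: the braids by
    Artin automorphisms and [t] by left translation. *)
Definition ann_rep m : {multiplicative annular_braid m -> sym (free_group nat)} :=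
  annular_lift (artin_annular m).

Lemma ann_rep_loop m i : i <= m.+1 ->
  ann_rep m (loop (ann_s m) (ann_t m) i) = translation (x_ i).
Proof.
elim: i => [_|i IH im]; first by rewrite loop0 annular_lift_t.
rewrite loopS homJ IH ?(ltnW im) // annular_lift_s // conjgE.
apply: (@mulgI _ (artin_sym i)); rewrite mulVKg.
rewrite [RHS]translation_conj; last exact: gmulfM.
by rewrite [artin_sym i _]artin_r.
Qed.

(** * The shifted loops are free generators *)

Section Freeness.
Context (m : nat).
Let X : choiceType := ('I_m.+1 * int)%type.

Definition shift (d : int) : {multiplicative free_group X -> free_group X} :=
  free_lift (fun x : X => free_gen ((x.1, (x.2 + d)%R) : X)).

Lemma shift_gen d i k :
  shift d (free_gen ((i, k) : X)) = free_gen ((i, (k + d)%R) : X).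
Proof. exact: free_lift_gen. Qed.

Lemma shiftK d e : (d + e = 0)%R -> cancel (shift d) (shift e).
Proof.
move=> de; apply: (free_hom_ext (f := shift e \o shift d) (g := idfun)) => -[i k].
rewrite -[LHS]/(shift e (shift d _)) !shift_gen /= -GRing.addrA de.
by rewrite GRing.addr0.
Qed.

Definition shift_sym : sym (free_group X) :=
  Sym (shiftK (GRing.addrN (1%R : int))) (shiftK (GRing.addNr (1%R : int))).

(** An action of the free group on the [x_ i] that sends [x_ 0] to the shift of
    the pairs, and [x_ i.+1 * (x_ 0)^-1] for [i <= m] to the translation by the
    pair [(i, 0)]. Conjugation by powers of [x_ 0] then gives all pairs. *)
Definition shift_rep : {multiplicative free_group nat -> sym (free_group X)} :=
  free_lift (fun i => if i is i'.+1
    then translation (free_gen ((inord i', 0%R) : X)) * shift_sym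
    else shift_sym).

Definition shifted_gen (x : X) : free_group nat :=
  (x_ x.1.+1 * (x_ 0)^-1) ^ (zpow (x_ 0) x.2)^-1.

Lemma shift_rep_shifted_gen (x : X) :
  shift_rep (shifted_gen x) = translation (free_gen x).
Proof.
case: x => i k; rewrite /shifted_gen homJ homV zpow_hom gmulfM homV !free_lift_gen.
rewrite mulgK inord_val /=; elim/int_step_ind: k => [|k IH|k IH].
- by rewrite /= invg1 conjg1.
- rewrite zpowS invgM conjgM IH conjgE invgK mulgA.
  rewrite translation_conj; last exact: gmulfM.
  by rewrite [shift_sym _]shift_gen mulgK.
- rewrite zpowP invgM invgK conjgM IH conjgE.
  apply: (@mulgI _ shift_sym); rewrite mulVKg.
  rewrite [RHS]translation_conj; last exact: gmulfM.
  by rewrite [shift_sym _]shift_gen GRing.subrK.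
Qed.

Definition loop_eval : {multiplicative free_group X -> annular_braid m} :=
  free_lift (fun x : X => shifted_loop (ann_s m) (ann_t m) x.1 x.2).

(** The Artin representation carries [loop_eval w] to the translation by a word
    in the [shifted_gen], and [shift_rep] carries this word to the translation
    by [w]. *)
Lemma loop_eval_inj : injective loop_eval.
Proof.
pose iota : {multiplicative free_group X -> free_group nat} :=
  free_lift shifted_gen.
have repE : ann_rep m \o loop_eval =1 @translation _ \o iota.
  apply: (free_hom_ext (f := ann_rep m \o loop_eval)
                       (g := @translation (free_group nat) \o iota)) => -[i k].
  rewrite -[LHS]/(ann_rep m (loop_eval _)) -[RHS]/(translation (iota _)).
  rewrite /iota !free_lift_gen /shifted_loop /shifted_gen /=.
  rewrite homJ gmulfM !homV zpow_hom annular_lift_t ann_rep_loop //.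
  by rewrite homJ gmulfM !homV zpow_hom.
have shift_repE : shift_rep \o iota =1 @translation (free_group X).
  apply: (free_hom_ext (f := shift_rep \o iota)) => x.
  by rewrite -[LHS]/(shift_rep (iota _)) /iota free_lift_gen shift_rep_shifted_gen.
(* translations are determined by their value at the identity *)
have tr_inj (G : groupType) : injective (@translation G).
  by move=> g h /(congr1 (fun f : sym _ => f 1)); rewrite /= !mulg1.
move=> v w vw; apply: (@tr_inj _); rewrite -!shift_repE /=; congr (shift_rep _).
apply: (@tr_inj _); have := repE w; rewrite -[LHS]/(ann_rep m (loop_eval w)) -vw.
by rewrite [LHS](repE v).
Qed.

Lemma loop_evalP g :
  generated (shifted_loops m (ann_s m) (ann_t m)) g <-> exists w, loop_eval w = g.
Proof.
have lE i k : i <= m -> loop_eval (free_gen ((inord i, k) : X)) =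
    shifted_loop (ann_s m) (ann_t m) i k.
  by move=> im; rewrite free_lift_gen /= inordK.
split=> [|[w <-]].
  elim=> [|_ h [i [k [im ->]]] _ [w <-]|_ h [i [k [im ->]]] _ [w <-]].
  - by exists 1; rewrite hom1.
  - by exists (free_gen ((inord i, k) : X) * w); rewrite gmulfM lE.
  - by exists ((free_gen ((inord i, k) : X))^-1 * w); rewrite gmulfM homV lE.
have Sx (x : X) : shifted_loops m (ann_s m) (ann_t m) (loop_eval (free_gen x)).
  by exists x.1, x.2; rewrite free_lift_gen -ltnS.
move: w; apply: presented_ind => [|x w IH|x w IH].
- by rewrite hom1; apply: generated1.
- by rewrite gmulfM; apply: generatedM IH; apply: Sx.
- by rewrite gmulfM homV; apply: generatedV IH; apply: Sx.
Qed.

End Freeness.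

(** * Conclusion *)

Section Image.
Context (m : nat).
Let in_emb g := exists h, aff_emb m h = g.

Lemma in_embM g h : in_emb g -> in_emb h -> in_emb (g * h).
Proof. by move=> [g' <-] [h' <-]; exists (g' * h'); rewrite gmulfM. Qed.

Lemma in_embV g : in_emb g -> in_emb g^-1.
Proof. by move=> [g' <-]; exists g'^-1; rewrite homV. Qed.

Lemma in_embJ g h : in_emb g -> in_emb h -> in_emb (g ^ h).
Proof. by move=> [g' <-] [h' <-]; exists (g' ^ h'); rewrite homJ. Qed.

(** The image of the embedding is stable under [rotation], hence under [t]; it
    thus contains the shifted loops. *)
Lemma aff_emb_rot h : aff_emb m (aff_rot m 1 h) =
  aff_emb m h ^ (rotation m (ann_s m) (ann_t m))^-1.
Proof.
move: h; apply: presented_ind => [|x h IH|x h IH].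
- by rewrite !hom1 conj1g.
- by rewrite pres_gen_aff !gmulfM IH conjMg aff_rot_gen !aff_emb_gen rotatedS.
- rewrite pres_gen_aff !gmulfM !homV IH conjMg aff_rot_gen !aff_emb_gen.
  by rewrite rotatedS conjVg.
Qed.

Lemma in_emb_partial_prod k : k <= m.+1 -> in_emb (partial_prod (ann_s m) k).
Proof.
move=> km; exists (partial_prod (aff_gen m) k); rewrite partial_prod_hom.
apply: eq_partial_prod => i ik.
by rewrite /= aff_emb_gen (rotated_s (annular_braidP m)) //; lia.
Qed.

Lemma in_emb_rot g : in_emb g -> in_emb (g ^ (rotation m (ann_s m) (ann_t m))).
Proof.
move=> [h <-]; exists (aff_rot m m.+1 h).
rewrite -{2}[h](aff_rotK (addn1 m.+1)) aff_emb_rot conjgKV //.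
Qed.

Lemma in_emb_rotV g : in_emb g -> in_emb (g ^ (rotation m (ann_s m) (ann_t m))^-1).
Proof. by move=> [h <-]; exists (aff_rot m 1 h); rewrite aff_emb_rot. Qed.

Lemma in_emb_t g : in_emb g -> in_emb (g ^ ann_t m).
Proof.
move=> gI; have -> : ann_t m =
    rotation m (ann_s m) (ann_t m) * (partial_prod (ann_s m) m.+1)^-1.
  by rewrite /rotation mulgK.
rewrite conjgM; apply: in_embJ; first exact: in_emb_rot.
exact/in_embV/in_emb_partial_prod.
Qed.

Lemma in_emb_tV g : in_emb g -> in_emb (g ^ (ann_t m)^-1).
Proof.
move=> gI; have -> : (ann_t m)^-1 =
    partial_prod (ann_s m) m.+1 * (rotation m (ann_s m) (ann_t m))^-1.
  by rewrite /rotation [(_ * _)^-1]invgM mulVKg.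
by rewrite conjgM; apply/in_emb_rotV/in_embJ => //; apply: in_emb_partial_prod.
Qed.

Lemma in_emb_shifted_loop i k : i <= m ->
  in_emb (shifted_loop (ann_s m) (ann_t m) i k).
Proof.
move=> im; elim/int_step_ind: k => [|k IH|k IH].
- have := @in_emb_partial_prod i.+1 im; rewrite shifted_loop0 /loop.
  move: (partial_prod _ _) => p pI; rewrite conjgE -!mulgA.
  apply: in_embM; first exact: in_embV.
  by have := in_emb_tV pI; rewrite conjgE invgK.
- by rewrite -shifted_loop_conjV; apply: in_emb_tV.
- by rewrite -shifted_loop_conj; apply: in_emb_t.
Qed.

End Image.

Lemma infinite_pairs m : infinite_set [set: 'I_m.+1 * int].
Proof.
move=> /(finite_image (fun x : 'I_m.+1 * int => absz x.2)).
rewrite (_ : _ @` _ = [set: nat]); first exact: infinite_nat.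
by apply/seteqP; split=> // n _; exists (ord0, Posz n).
Qed.

(** Preimages of the shifted loops under the embedding generate freely, since
    the shifted loops do. They generate a normal subgroup, which contains [e]
    and hence its normal closure, the kernel; conversely the projection of the
    annular braid group, which extends [beta], kills the shifted loops. *)
Lemma kernel_free m (n_gt0 : 0 < m.+1) :
  free_of_infinite_rank (morph_ker (beta n_gt0)).
Proof.
have zeta (x : 'I_m.+1 * int) : {h | aff_emb m h =
    shifted_loop (ann_s m) (ann_t m) x.1 x.2}.
  by apply/cid/in_emb_shifted_loop; rewrite -ltnS.
pose f := free_lift (fun x => projT1 (zeta x)).
have fE w : aff_emb m (f w) = loop_eval m w.
  move: w; apply: (free_hom_ext (f := aff_emb m \o f)) => x.
  by rewrite -[LHS]/(aff_emb m (f _)) /f !free_lift_gen; case: (zeta x).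
exists ('I_m.+1 * int)%type, f; split; first exact: infinite_pairs.
  by move=> v w vw; apply: loop_eval_inj; rewrite -!fE vw.
apply/seteqP; split=> [_ [w _ <-]|h].
  rewrite -[morph_ker _ _]/(beta n_gt0 (f w) = 1) -ann_proj_emb.
  rewrite -[LHS]/(ann_proj m (aff_emb m (f w))) fE.
  apply: (@shifted_loops_ker m _ _ (ann_s m) (ann_t m)).
    by move=> i im; rewrite annular_lift_t; apply/commute_sym/commute1.
  by apply/loop_evalP; exists w.
pose P : set (braid_affA m.+1) := [set x |
  generated (shifted_loops m (ann_s m) (ann_t m)) (aff_emb m x)].
have PN : normal_subgroup P.
  split=> [|x y|x|x g]; rewrite /P /mkset.
  - by rewrite hom1; apply: generated1.
  - by rewrite gmulfM; apply: generated_mul.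
  - by rewrite homV; apply: generated_inv.
  - by rewrite homJ; apply: shifted_loops_normal.
have Pe : [set aff_e n_gt0] `<=` P.
  move=> _ ->; rewrite /P /mkset aff_emb_e; apply/generated_inv/generated_gen.
  by exists m, 0%R.
rewrite -normal_closure_beta => /(_ P (conj PN Pe))/loop_evalP[w wE].
by exists w => //; apply: (@aff_emb_inj m); rewrite fE.
Qed.

Theorem mainTheorem2 (n : nat) (n_gt0 : (1 <= n)%N) :
  let N_e := normal_closure [set aff_e n_gt0] in
  [/\ range (beta n_gt0) = [set: braid_A n],
      N_e = morph_ker (beta n_gt0)
    & free_of_infinite_rank N_e].
Proof.
case: n n_gt0 => // m n_gt0 N_e; have NE := normal_closure_beta n_gt0.
split=> //; first exact: beta_surj.
by rewrite /N_e NE; apply: kernel_free.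
Qed.
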